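(* Let $A$ be a Cohen-Macaulay ring, let $J$ be the Jacobson radical of $A$, and let $\omega_A$ be a canonical $A$-module. Then the following are equivalent: (1) $A$ is a Hilbert ring. (2) $r(J,\omega_A)=A$. (3) $r(J^n,\omega_A)=A$ for all $n\geq 1$.
   Context: All rings are commutative Noetherian with unity and all modules are finitely generated. The Jacobson radical $J$ of $A$ is the intersection of all maximal ideals of $A$. In this setting, a Noetherian ring $A$ is called a Hilbert ring if its Jacobson radical is nilpotent. A canonical module of a Cohen-Macaulay ring $A$ is a finitely generated $A$-module $\omega_A$ such that $(\omega_A)_{\mathfrak m}$ is a canonical module of the local ring $A_{\mathfrak m}$ for every maximal ideal $\mathfrak m$. For an ideal $I$, an $A$-module $M$ and $n\ge 1$, $r(I^n,M)=\bigcup_{k\ge 0}(I^{n+k}M:_A I^kM)\subseteq A$ (the stable value of an ascending chain of ideals). *)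

(* Defs.v *)
From HB Require Import structures.
From mathcomp Require Import all_boot all_order all_algebra.
From mathcomp Require Import boolp classical_sets.
From mathcomp Require Import ring.

Set Implicit Arguments.
Unset Strict Implicit.
Unset Printing Implicit Defensive.

Import GRing.Theory.
Local Open Scope classical_set_scope.
Local Open Scope ring_scope.
Local Open Scope quotient_scope.

(* MathComp has neither submodules given by arbitrary (Prop-valued) subsets,
   nor localization at a multiplicative set, nor depth, Krull dimension, Ext or
   injective resolutions; they are set up below for modules over a
   [comPzRingType].  Ideals of [A] are the submodules of the regular module
   [A^o]; in particular the unit ideal is an [ideal A]. *)

Record submodule (A : comPzRingType) (M : lmodType A) := Submodule {
  subset_of :> M -> Prop;
  submod0 : subset_of 0;
  submodZD : forall (a : A) (u v : M),
    subset_of u -> subset_of v -> subset_of (a *: u + v) }.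

Notation ideal A := (submodule (A^o : lmodType A)).

Section Submodules.
Variables (A : comPzRingType) (M : lmodType A).

Lemma submodD (N : submodule M) u v : N u -> N v -> N (u + v).
Proof. by move=> Nu Nv; rewrite -[u]scale1r; apply: submodZD. Qed.

Lemma submodZ (N : submodule M) a u : N u -> N (a *: u).
Proof.
by move=> Nu; rewrite -[_ *: u]addr0; apply: submodZD => //; apply: submod0.
Qed.

Lemma submodN (N : submodule M) u : N u -> N (- u).
Proof. by move=> Nu; rewrite -scaleN1r; apply: submodZ. Qed.

Definition spans n (x : 'I_n -> M) (N : set M) : Prop :=
  (forall i, N (x i)) /\
  (forall u, N u -> exists c : 'I_n -> A, u = \sum_(i < n) c i *: x i).

Definition fg_set (N : set M) : Prop := exists n (x : 'I_n -> M), spans x N.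

Definition fg_module : Prop := fg_set setT.

Definition annihilator : set A := [set a | forall u : M, a *: u = 0].

(* I N, the set of finite sums of products of an element of I by one of N. *)
Definition ideal_mul (I : set A) (N : set M) : set M :=
  [set u | exists n (a : 'I_n -> A) (x : 'I_n -> M),
    [/\ forall i, I (a i), forall i, N (x i) & u = \sum_(i < n) a i *: x i]].

Definition colon (N L : set M) : set A := [set a | forall u, L u -> N (a *: u)].

End Submodules.

Arguments fg_module {A} M.
Arguments annihilator {A} M.

Section SubmoduleType.
Variables (A : comPzRingType) (M : lmodType A) (N : submodule M).

Definition submod_mem (u : M) : bool := `[< N u >].

Fact submod_mem_closed : submod_closed submod_mem.
Proof.
split; first exact/asboolP/submod0.
by move=> a u v /asboolP Nu /asboolP Nv; apply/asboolP/submodZD.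
Qed.

HB.instance Definition _ :=
  GRing.isSubmodClosed.Build A M submod_mem submod_mem_closed.

Definition submod_type : Type := {u : M | submod_mem u}.

HB.instance Definition _ := SubChoice.on submod_type.
HB.instance Definition _ := [SubChoice_isSubLmodule of submod_type by <:].

End SubmoduleType.

Section QuotientModule.
Variables (A : comPzRingType) (M : lmodType A) (N : submodule M).

Definition submod_zmodClosed : zmodClosed M :=
  GRing.ZmodClosed.clone M (submod_mem N) _.

Definition quot_module : Type := Quotient.quot submod_zmodClosed.

HB.instance Definition _ := GRing.Zmodule.on quot_module.

Definition quot_pi (u : M) : quot_module :=
  \pi_(Quotient.quot submod_zmodClosed) u.

Lemma quot_piP (u v : M) : quot_pi u = quot_pi v <-> N (u - v).
Proof.
have eqE := Quotient.idealrBE submod_zmodClosed u v.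
split=> [/eqP | Nuv]; first by rewrite /quot_pi -eqE => /asboolP.
by apply/eqP; rewrite /quot_pi -eqE; apply/asboolP.
Qed.

Lemma quot_piD u v : quot_pi (u + v) = quot_pi u + quot_pi v.
Proof. exact: (raddfD (\pi_(Quotient.quot submod_zmodClosed))). Qed.

Lemma quot_pi_surj (x : quot_module) : exists u, x = quot_pi u.
Proof. by exists (repr x); rewrite /quot_pi reprK. Qed.

Definition quot_scale (a : A) (x : quot_module) : quot_module :=
  quot_pi (a *: repr x).

Lemma quot_scale_pi a u : quot_scale a (quot_pi u) = quot_pi (a *: u).
Proof.
apply/quot_piP; rewrite -scalerBr; apply/submodZ/quot_piP.
by rewrite /quot_pi reprK.
Qed.

Fact quot_scaleA a b x : quot_scale a (quot_scale b x) = quot_scale (a * b) x.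
Proof. by have [u ->] := quot_pi_surj x; rewrite !quot_scale_pi scalerA. Qed.

Fact quot_scale1 : left_id 1 quot_scale.
Proof.
by move=> x; have [u ->] := quot_pi_surj x; rewrite quot_scale_pi scale1r.
Qed.

Fact quot_scaleDr : right_distributive quot_scale +%R.
Proof.
move=> a x y; have [u ->] := quot_pi_surj x; have [v ->] := quot_pi_surj y.
by rewrite -quot_piD !quot_scale_pi scalerDr quot_piD.
Qed.

Fact quot_scaleDl x : {morph quot_scale^~ x : a b / a + b}.
Proof.
move=> a b; have [u ->] := quot_pi_surj x.
by rewrite !quot_scale_pi scalerDl quot_piD.
Qed.

HB.instance Definition _ := GRing.Zmodule_isLmodule.Build A quot_module
  quot_scaleA quot_scale1 quot_scaleDr quot_scaleDl.

Fact quot_pi_is_linear : linear quot_pi.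
Proof. by move=> a u v; rewrite quot_piD -quot_scale_pi. Qed.

HB.instance Definition _ :=
  GRing.isLinear.Build A M quot_module *:%R quot_pi quot_pi_is_linear.

End QuotientModule.

Record mulset (A : comPzRingType) := Mulset {
  mulset_set :> A -> Prop;
  mulset1 : mulset_set 1;
  mulsetM : forall s t, mulset_set s -> mulset_set t -> mulset_set (s * t) }.

Section Localization.
Variables (A : comPzRingType) (S : mulset A).

Definition denom : Type := {s : A | `[< S s >]}.

HB.instance Definition _ := SubChoice.on denom.

Definition den (s : denom) : A := val s.

Lemma denomP (s : denom) : S (den s).
Proof. exact/asboolP/(valP s). Qed.

Definition Denom (s : A) (Ss : S s) : denom := exist _ s (asboolT Ss).

Definition denom1 : denom := Denom (mulset1 S).

Definition denomM (s t : denom) : denom :=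
  Denom (mulsetM (denomP s) (denomP t)).

Lemma den1 : den denom1 = 1. Proof. by []. Qed.

Lemma denM s t : den (denomM s t) = den s * den t. Proof. by []. Qed.

Definition denE := (den1, denM).

Section LocalizedModule.
Variable M : lmodType A.

(* (u, s) stands for u / s; u / s = v / t iff w (t u) = w (s v) for some w in
   S. *)
Definition frac_equiv (x y : M * denom) : bool :=
  `[< exists2 w, S w &
        w *: (den y.2 *: x.1) = w *: (den x.2 *: y.1) >].

Fact frac_equiv_refl : reflexive frac_equiv.
Proof. by move=> x; apply/asboolP; exists 1 => //; apply: mulset1. Qed.

Fact frac_equiv_sym : symmetric frac_equiv.
Proof. by move=> x y; apply/asboolP/asboolP => -[w Sw ?]; exists w. Qed.

Fact frac_equiv_trans : transitive frac_equiv.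
Proof.
move=> [v t] [u s] [w r] /asboolP[a Sa /= E1] /asboolP[b Sb /= E2].
apply/asboolP; exists (a * b * den t) => /=.
  by apply/mulsetM/denomP/mulsetM.
transitivity ((b * den r) *: (a *: (den t *: u))).
  by rewrite !scalerA; congr (_ *: _); ring.
rewrite E1; transitivity ((a * den s) *: (b *: (den r *: v))).
  by rewrite !scalerA; congr (_ *: _); ring.
by rewrite E2 !scalerA; congr (_ *: _); ring.
Qed.

Canonical frac_equiv_rel :=
  EquivRel frac_equiv frac_equiv_refl frac_equiv_sym frac_equiv_trans.

Definition loc_module : Type := {eq_quot frac_equiv_rel}.

HB.instance Definition _ := Choice.on loc_module.

Definition frac (u : M) (s : denom) : loc_module :=
  \pi_{eq_quot frac_equiv_rel} (u, s).

Lemma fracP (u v : M) (s t : denom) :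
  frac u s = frac v t <->
  exists2 w, S w & w *: (den t *: u) = w *: (den s *: v).
Proof.
split; first by move/eqmodP/asboolP.
by move=> H; apply/eqmodP/asboolP.
Qed.

Lemma frac_surj (x : loc_module) : exists u s, x = frac u s.
Proof.
by exists (repr x).1, (repr x).2; rewrite /frac -surjective_pairing reprK.
Qed.

Lemma frac_reprP u s : exists2 w, S w &
  w *: (den s *: (repr (frac u s)).1) = w *: (den (repr (frac u s)).2 *: u).
Proof. by apply/fracP; rewrite /frac -surjective_pairing reprK. Qed.

Definition loc_zero : loc_module := frac 0 denom1.
Definition loc_opp (x : loc_module) : loc_module :=
  frac (- (repr x).1) (repr x).2.
Definition loc_add (x y : loc_module) : loc_module :=
  frac (den (repr y).2 *: (repr x).1 + den (repr x).2 *: (repr y).1)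
       (denomM (repr x).2 (repr y).2).

Lemma loc_oppE u s : loc_opp (frac u s) = frac (- u) s.
Proof.
apply/fracP; have [w Sw E] := frac_reprP u s; exists w => //.
by rewrite !scalerN E.
Qed.

Lemma loc_addE u s v t :
  loc_add (frac u s) (frac v t) =
  frac (den t *: u + den s *: v) (denomM s t).
Proof.
apply/fracP; have [a Sa] := frac_reprP u s; have [b Sb] := frac_reprP v t.
case: (repr _) => v' t' /= Eb; case: (repr _) => u' s' /= Ea.
exists (a * b); first exact: mulsetM.
rewrite ?denE.
rewrite !scalerDr; congr (_ + _).
  transitivity ((b * den t * den t') *: (a *: (den s *: u'))).
    by rewrite !scalerA; congr (_ *: _); ring.
  by rewrite Ea !scalerA; congr (_ *: _); ring.
transitivity ((a * den s * den s') *: (b *: (den t *: v'))).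
  by rewrite !scalerA; congr (_ *: _); ring.
by rewrite Eb !scalerA; congr (_ *: _); ring.
Qed.

Lemma frac_eq (u v : M) (s t : denom) :
  den t *: u = den s *: v -> frac u s = frac v t.
Proof. by move=> E; apply/fracP; exists 1; rewrite ?E //; apply: mulset1. Qed.

Fact loc_addA : associative loc_add.
Proof.
move=> x y z; have [u [s ->]] := frac_surj x; have [v [t ->]] := frac_surj y.
have [w [r ->]] := frac_surj z; rewrite !loc_addE; apply: frac_eq; rewrite ?denE.
by rewrite !scalerDr !scalerA addrA; congr (_ *: _ + _ *: _ + _ *: _); ring.
Qed.

Fact loc_addC : commutative loc_add.
Proof.
move=> x y; have [u [s ->]] := frac_surj x; have [v [t ->]] := frac_surj y.
by rewrite !loc_addE; apply: frac_eq; rewrite ?denE mulrC addrC.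
Qed.

Fact loc_add0 : left_id loc_zero loc_add.
Proof.
move=> x; have [u [s ->]] := frac_surj x; rewrite loc_addE.
by apply: frac_eq; rewrite ?denE scaler0 add0r scale1r mul1r.
Qed.

Fact loc_addN : left_inverse loc_zero loc_opp loc_add.
Proof.
move=> x; have [u [s ->]] := frac_surj x; rewrite loc_oppE loc_addE.
by apply: frac_eq; rewrite scalerN addNr !scaler0.
Qed.

HB.instance Definition _ :=
  GRing.isZmodule.Build loc_module loc_addA loc_addC loc_add0 loc_addN.

Lemma fracD u s v t :
  frac u s + frac v t = frac (den t *: u + den s *: v) (denomM s t).
Proof. exact: loc_addE. Qed.

End LocalizedModule.

Definition loc_ring : Type := loc_module (A^o : lmodType A).

HB.instance Definition _ := GRing.Zmodule.on loc_ring.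

Definition rfrac (a : A) (s : denom) : loc_ring := frac (a : A^o) s.

Lemma rfracP (a b : A) (s t : denom) :
  rfrac a s = rfrac b t <->
  exists2 w, S w & w * (den t * a) = w * (den s * b).
Proof. exact: (@fracP (A^o : lmodType A)). Qed.

Lemma rfrac_eq (a b : A) (s t : denom) :
  den t * a = den s * b -> rfrac a s = rfrac b t.
Proof. exact: (@frac_eq (A^o : lmodType A)). Qed.

Lemma rfrac_surj (x : loc_ring) : exists a s, x = rfrac a s.
Proof. exact: (@frac_surj (A^o : lmodType A)). Qed.

Lemma rfracD a s b t :
  rfrac a s + rfrac b t = rfrac (den t * a + den s * b) (denomM s t).
Proof. exact: (@fracD (A^o : lmodType A)). Qed.

Definition loc_one : loc_ring := rfrac 1 denom1.

Section LocalizedScaling.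
Variable M : lmodType A.

Definition loc_scale (x : loc_ring) (y : loc_module M) : loc_module M :=
  frac ((repr x).1 *: (repr y).1) (denomM (repr x).2 (repr y).2).

Lemma loc_scaleE a s (u : M) t :
  loc_scale (rfrac a s) (frac u t) = frac (a *: u) (denomM s t).
Proof.
apply/fracP; have [b Sb] := frac_reprP (a : A^o) s.
have [c Sc] := frac_reprP u t; rewrite -/(rfrac a s).
case: (repr (frac u t)) => u' t' /= Ec; case: (repr _) => a' s' /= Eb.
exists (b * c); first exact: mulsetM.
rewrite ?denE.
transitivity ((b * (den s * a')) *: (c *: (den t *: u'))).
  by rewrite !scalerA; congr (_ *: _); ring.
have -> : b * (den s * a') = b * (den s' * a) by exact: Eb.
by rewrite Ec !scalerA; congr (_ *: _); ring.
Qed.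

End LocalizedScaling.

Definition loc_mul (x y : loc_ring) : loc_ring := loc_scale x y.

Lemma loc_mulE a s b t :
  loc_mul (rfrac a s) (rfrac b t) = rfrac (a * b) (denomM s t).
Proof. exact: loc_scaleE. Qed.

Fact loc_mulA : associative loc_mul.
Proof.
move=> x y z; have [a [s ->]] := rfrac_surj x; have [b [t ->]] := rfrac_surj y.
have [c [r ->]] := rfrac_surj z; rewrite !loc_mulE.
by apply: rfrac_eq; rewrite ?denE; ring.
Qed.

Fact loc_mulC : commutative loc_mul.
Proof.
move=> x y; have [a [s ->]] := rfrac_surj x; have [b [t ->]] := rfrac_surj y.
by rewrite !loc_mulE; apply: rfrac_eq; rewrite ?denE; ring.
Qed.

Fact loc_mul1 : left_id loc_one loc_mul.
Proof.
move=> x; have [a [s ->]] := rfrac_surj x; rewrite loc_mulE.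
by apply: rfrac_eq; rewrite ?denE; ring.
Qed.

Fact loc_mulDl : left_distributive loc_mul +%R.
Proof.
move=> x y z; have [a [s ->]] := rfrac_surj x; have [b [t ->]] := rfrac_surj y.
have [c [r ->]] := rfrac_surj z; rewrite !(rfracD, loc_mulE).
by apply: rfrac_eq; rewrite ?denE; ring.
Qed.

HB.instance Definition _ := GRing.Zmodule_isComPzRing.Build loc_ring
  loc_mulA loc_mulC loc_mul1 loc_mulDl.

Section LocalizedModuleStructure.
Variable M : lmodType A.

Fact loc_scaleA (x y : loc_ring) (z : loc_module M) :
  loc_scale x (loc_scale y z) = loc_scale (x * y) z.
Proof.
have [a [s ->]] := rfrac_surj x; have [b [t ->]] := rfrac_surj y.
have [u [r ->]] := frac_surj z; rewrite [_ * _]loc_mulE !loc_scaleE.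
by apply: frac_eq; rewrite ?denE !scalerA; congr (_ *: _); ring.
Qed.

Fact loc_scale1 : left_id 1 (@loc_scale M).
Proof.
move=> z; have [u [r ->]] := frac_surj z; rewrite -[1]/loc_one loc_scaleE.
by apply: frac_eq; rewrite ?denE scale1r mul1r.
Qed.

Fact loc_scaleDr : right_distributive (@loc_scale M) +%R.
Proof.
move=> x y z; have [a [s ->]] := rfrac_surj x; have [v [t ->]] := frac_surj y.
have [u [r ->]] := frac_surj z; rewrite !(fracD, loc_scaleE).
apply: frac_eq; rewrite ?denE !(scalerDr, scalerA).
by congr (_ *: _ + _ *: _); ring.
Qed.

Fact loc_scaleDl (z : loc_module M) :
  {morph (@loc_scale M)^~ z : x y / x + y}.
Proof.
move=> x y; have [a [s ->]] := rfrac_surj x; have [b [t ->]] := rfrac_surj y.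
have [u [r ->]] := frac_surj z; rewrite rfracD !(fracD, loc_scaleE).
apply: frac_eq; rewrite ?denE !(scalerDr, scalerDl, scalerA).
by rewrite -scalerDl; congr (_ *: _); ring.
Qed.

HB.instance Definition _ :=
  GRing.Zmodule_isLmodule.Build loc_ring (loc_module M)
  loc_scaleA loc_scale1 loc_scaleDr loc_scaleDl.

End LocalizedModuleStructure.

End Localization.

Section Ideals.
Variable A : comPzRingType.

Definition noetherian_ring : Prop := forall I : ideal A, fg_set I.

Definition prime_ideal (p : ideal A) : Prop :=
  ~ p 1 /\ (forall a b : A, p (a * b) -> p a \/ p b).

Definition maximal_ideal (m : ideal A) : Prop :=
  ~ m 1 /\ (forall I : ideal A, m `<=` I -> I 1 \/ I `<=` m).

Definition jacobson : set A :=
  [set a | forall m : ideal A, maximal_ideal m -> m a].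

(* In particular ideal_exp I 0 is the whole ring. *)
Definition ideal_exp (I : set A) (n : nat) : set A :=
  iter n (@ideal_mul A (A^o : lmodType A) I) setT.

Definition hilbert_ring : Prop :=
  exists n, ideal_exp jacobson n `<=` [set 0].

Definition stable_colon (I : set A) (n : nat) (M : lmodType A) : set A :=
  \bigcup_k colon (ideal_mul (ideal_exp I (n + k)) [set: M])
                  (ideal_mul (ideal_exp I k) [set: M]).

Fact add_ideal_closed (m : ideal A) (a : A) :
  let I := [set x : A^o | exists2 y, m y & exists b : A, x = y + b * a] in
  I 0 /\ (forall (c : A) (u v : A^o), I u -> I v -> I (c *: u + v)).
Proof.
split=> [|c _ _ [y my [b ->]] [z mz [d ->]]].
  by exists 0; [apply: submod0 | exists 0; rewrite mul0r addr0].
exists (c *: y + z); first exact: submodZD.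
exists (c * b + d); rewrite /GRing.scale /=; ring.
Qed.

Lemma maximal_ideal_prime (m : ideal A) : maximal_ideal m -> prime_ideal m.
Proof.
case=> m1 mmax; split=> // a b mab.
have [ma|ma] := pselect (m a); [by left | right].
have [I0 IZD] := add_ideal_closed m a.
have [x mx|[y my [c E]]|Im] := mmax (Submodule I0 IZD).
- by exists x => //; exists 0; rewrite mul0r addr0.
- have -> : b = (b : A) *: (y : A^o) + (c : A) *: (a * b : A^o).
    by rewrite /GRing.scale /= -[LHS]mulr1 E; ring.
  by apply: submodZD => //; apply: submodZ.
- by case: ma; apply: Im; exists 0; [apply: submod0 | exists 1; ring].
Qed.

Definition prime_compl (p : ideal A) (pP : prime_ideal p) : mulset A :=
  @Mulset A (fun s => ~ p s) (proj1 pP)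
    (fun s t ps pt pst => or_ind ps pt (proj2 pP s t pst)).

(* A chain p_0 < ... < p_d of prime ideals containing I; these correspond to
   the chains of length d of primes of A / I. *)
Definition prime_chain (I : set A) (d : nat) : Prop :=
  exists p : nat -> ideal A,
    (forall i, (i <= d)%N -> prime_ideal (p i) /\ I `<=` p i) /\
    (forall i, (i < d)%N -> p i `<` p i.+1).

Definition quotient_dim (I : set A) (d : nat) : Prop :=
  prime_chain I d /\ ~ prime_chain I d.+1.

Definition krull_dim (d : nat) : Prop := quotient_dim [set 0] d.

Definition module_dim (M : lmodType A) (d : nat) : Prop :=
  quotient_dim (annihilator M) d.

End Ideals.

Arguments jacobson A : clear implicits.

Definition localize (A : comPzRingType) (p : ideal A) (pP : prime_ideal p) :=
  loc_ring (prime_compl pP).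

Definition localize_module (A : comPzRingType) (M : lmodType A)
    (p : ideal A) (pP : prime_ideal p) :=
  loc_module (prime_compl pP) M.

Section HomologicalAlgebra.
Variable B : comPzRingType.

Definition exact_at (U V W : lmodType B) (f : U -> V) (g : V -> W) : Prop :=
  forall v, g v = 0 <-> exists u, v = f u.

Definition injective_module (E : lmodType B) : Prop :=
  forall (U V : lmodType B) (i : {linear U -> V}) (f : {linear U -> E}),
    injective i -> exists g : {linear V -> E}, forall u, g (i u) = f u.

Definition finite_injective_dim (M : lmodType B) : Prop :=
  exists (n : nat) (E : nat -> lmodType B) (e : {linear M -> E 0%N})
         (d : forall i, {linear E i -> E i.+1}),
    [/\ forall i, injective_module (E i),
        injective e /\ exact_at e (d 0%N),
        forall i, exact_at (d i) (d i.+1) &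
        forall i, (n < i)%N -> forall x : E i, x = 0].

(* A resolution of N by free modules B^(res_rank i) of finite rank; linear maps
   act on row vectors by right multiplication. *)
Record free_resolution (N : lmodType B) := FreeResolution {
  res_rank : nat -> nat;
  res_diff : forall i, 'M[B]_(res_rank i.+1, res_rank i);
  res_aug : {linear 'rV[B]_(res_rank 0) -> N};
  res_aug_surj : forall x, exists v, x = res_aug v;
  res_aug_exact :
    exact_at (fun w : 'rV[B]_(res_rank 1) => w *m res_diff 0) res_aug;
  res_exact : forall i,
    exact_at (fun w : 'rV[B]_(res_rank i.+2) => w *m res_diff i.+1)
             (fun v : 'rV[B]_(res_rank i.+1) => v *m res_diff i) }.

Section Ext.
Variables (N : lmodType B) (F : free_resolution N) (M : lmodType B).

(* Hom(B^n, M) is identified with M^n through the values on the standard basis;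
   coboundary is then precomposition with the differential of F. *)
Definition cochain (i : nat) : lmodType B := {ffun 'I_(res_rank F i) -> M}.

Definition coboundary (i : nat) (phi : cochain i) : cochain i.+1 :=
  [ffun j => \sum_k res_diff F i j k *: phi k].

Fact coboundary_is_linear i : linear (@coboundary i).
Proof.
move=> a phi psi; apply/ffunP=> j; rewrite !ffunE scaler_sumr -big_split /=.
apply: eq_bigr => k _; rewrite !ffunE scalerDr !scalerA.
by congr (_ *: _ + _); ring.
Qed.

HB.instance Definition _ i :=
  GRing.isLinear.Build B (cochain i) (cochain i.+1) *:%R (@coboundary i)
    (@coboundary_is_linear i).

Definition is_coboundary (i : nat) : cochain i -> Prop :=
  match i with
  | 0 => fun phi => phi = 0
  | j.+1 => fun phi => exists psi : cochain j, phi = coboundary psi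
  end.

Fact cocycles0 i : coboundary (0 : cochain i) = 0.
Proof. exact: linear0. Qed.

Fact cocyclesZD i (a : B) (phi psi : cochain i) :
  coboundary phi = 0 -> coboundary psi = 0 -> coboundary (a *: phi + psi) = 0.
Proof. by move=> E1 E2; rewrite coboundary_is_linear E1 E2 scaler0 addr0. Qed.

Definition cocycles (i : nat) : submodule (cochain i) :=
  Submodule (@cocycles0 i) (@cocyclesZD i).

Fact is_coboundary0 i : is_coboundary (0 : cochain i).
Proof. by case: i => [|i] //=; exists 0; rewrite linear0. Qed.

Fact is_coboundaryZD i (a : B) (phi psi : cochain i) :
  is_coboundary phi -> is_coboundary psi -> is_coboundary (a *: phi + psi).
Proof.
case: i phi psi => [|i] phi psi /=.
  by move=> -> ->; rewrite scaler0 addr0.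
by move=> [f ->] [g ->]; exists (a *: f + g); rewrite coboundary_is_linear.
Qed.

Definition coboundaries (i : nat) : submodule (submod_type (cocycles i)) :=
  @Submodule B (submod_type (cocycles i)) (fun z => is_coboundary (val z))
    (is_coboundary0 i)
    (fun a u v => @is_coboundaryZD i a (val u) (val v)).

(* Ext^i_B(N, M), computed from the resolution F of N. *)
Definition Ext (i : nat) : lmodType B := quot_module (coboundaries i).

End Ext.

Definition local_ring (m : ideal B) : Prop :=
  maximal_ideal m /\
  (forall m' : ideal B, maximal_ideal m' -> m' = m :> set B).

Definition residue_field (m : ideal B) : lmodType B := quot_module m.

(* (s) M, for s = (s_0, ..., s_(n-1)) *)
Definition seq_mul (M : lmodType B) (s : seq B) : set M :=
  [set u | exists x : 'I_(size s) -> M, u = \sum_(i < size s) s`_i *: x i].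

Arguments seq_mul M s : clear implicits.

Definition regular_seq (M : lmodType B) (s : seq B) : Prop :=
  (forall i, (i < size s)%N -> forall u : M,
     seq_mul M (take i s) (s`_i *: u) -> seq_mul M (take i s) u) /\
  seq_mul M s <> setT.

Definition regular_seq_in (m : ideal B) (M : lmodType B) (n : nat) : Prop :=
  exists s : seq B,
    [/\ size s = n, forall a, a \in s -> m a & regular_seq M s].

Definition depth (m : ideal B) (M : lmodType B) (t : nat) : Prop :=
  regular_seq_in m M t /\ ~ regular_seq_in m M t.+1.

(* dim_k Ext^t(k, M) = r with t = depth M: as k = B / m, a k-vector space of
   dimension r is a B-module isomorphic to k^r. *)
Definition cm_type (m : ideal B) (M : lmodType B) (r : nat) : Prop :=
  exists t, depth m M t /\
  exists (F : free_resolution (residue_field m))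
         (f : {linear {ffun 'I_r -> residue_field m} -> Ext F M t}),
    bijective f.

Definition cm_module (m : ideal B) (M : lmodType B) : Prop :=
  exists d, depth m M d /\ module_dim M d.

Definition maximal_cm_module (m : ideal B) (M : lmodType B) : Prop :=
  exists d, [/\ depth m M d, module_dim M d & krull_dim B d].

Definition cm_local_ring : Prop :=
  exists m : ideal B, local_ring m /\ cm_module m B^o.

(* Bruns-Herzog, Cohen-Macaulay Rings, Definition 3.3.1 *)
Definition local_canonical_module (C : lmodType B) : Prop :=
  exists m : ideal B,
    [/\ local_ring m, fg_module C, maximal_cm_module m C, cm_type m C 1 &
        finite_injective_dim C].

End HomologicalAlgebra.

Definition cohen_macaulay_ring (A : comPzRingType) : Prop :=
  forall (m : ideal A) (mM : maximal_ideal m),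
    cm_local_ring (localize (maximal_ideal_prime mM)).

Definition canonical_module (A : comPzRingType) (omega : lmodType A) : Prop :=
  fg_module omega /\
  (forall (m : ideal A) (mM : maximal_ideal m),
    local_canonical_module
      (localize_module omega (maximal_ideal_prime mM))).

(* Main.v *)
(* By Nakayama, r(J, omega) = A forces J^k omega = 0 for some k, so everything
   rests on the faithfulness of omega, which is checked at each maximal ideal.
   Over a Cohen-Macaulay local ring B of dimension d let C be a maximal
   Cohen-Macaulay module of finite injective dimension. By prime avoidance and
   the exchange property of regular sequences there is a sequence x of length d
   regular on both B and C. By Rees' theorem C/xC has finite injective dimension
   over the Artinian ring B/x; since B/x contains a copy of the residue field,
   socle elements lift along injective resolutions, and C/xC is a faithful
   B/x-module. Nakayama's lemma then shows by descending induction that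
   C/(x_1, ..., x_i)C is faithful over B/(x_1, ..., x_i). *)

Require Import Defs.
From HB Require Import structures.
From mathcomp Require Import all_boot all_order all_algebra.
From mathcomp Require Import boolp classical_sets.
From mathcomp Require Import ring.
From Stdlib Require List.

Import GRing.Theory.
Local Open Scope classical_set_scope.
Local Open Scope ring_scope.

Set Implicit Arguments.
Unset Strict Implicit.
Unset Printing Implicit Defensive.

(** * Submodules, Noetherian induction and Nakayama's lemma *)

Section NoetherianModules.
Context {A : comPzRingType}.
Implicit Types M : lmodType A.

Lemma submod_sum M (N : submodule M) n (u : 'I_n -> M) :
  (forall i, N (u i)) -> N (\sum_(i < n) u i).
Proof.
by move=> Nu; elim/big_ind: _ => //; [apply: submod0 | move=> ? ?; apply: submodD].
Qed.

Lemma submodB M (N : submodule M) u v : N u -> N v -> N (u - v).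
Proof. by move=> Nu Nv; apply: submodD => //; apply: submodN. Qed.

Lemma idealMl (I : ideal A) (a b : A) : I b -> I (a * b).
Proof. exact: (@submodZ A A^o). Qed.

Lemma idealMr (I : ideal A) (a b : A) : I a -> I (a * b).
Proof. by rewrite mulrC; apply: idealMl. Qed.

Definition full_submod M : submodule M :=
  @Submodule A M (fun _ => True) I (fun _ _ _ _ _ => I).

Definition zero_submod M : submodule M.
Proof.
exists (fun u => u = 0) => // a u v -> ->; by rewrite scaler0 addr0.
Defined.

Definition meet_submod M (N L : submodule M) : submodule M.
Proof.
exists (fun u => N u /\ L u); first by split; apply: submod0.
by move=> a u v [? ?] [? ?]; split; apply: submodZD.
Defined.

Definition add_submod M (N L : submodule M) : submodule M.
Proof.
exists (fun u => exists2 v, N v & exists2 w, L w & u = v + w).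
  by exists 0; [apply: submod0 | exists 0; [apply: submod0 | rewrite addr0]].
move=> a _ _ [v Nv [w Lw ->]] [v' Nv' [w' Lw' ->]].
exists (a *: v + v'); first exact: submodZD.
by exists (a *: w + w'); [exact: submodZD | rewrite scalerDr addrACA].
Defined.

Definition cyclic_submod M (u : M) : submodule M.
Proof.
exists (fun v => exists b : A, v = b *: u); first by exists 0; rewrite scale0r.
by move=> c _ _ [b ->] [b' ->]; exists (c * b + b'); rewrite scalerDl -scalerA.
Defined.

Definition mod_elt M (N : submodule M) (x : A) : submodule M.
Proof.
exists (fun u => exists2 v, N v & exists w, u = v + x *: w).
  by exists 0; [apply: submod0 | exists 0; rewrite scaler0 addr0].
move=> a _ _ [v Nv [w ->]] [v' Nv' [w' ->]].
exists (a *: v + v'); first exact: submodZD.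
by exists (a *: w + w'); rewrite !scalerDr !scalerA addrACA mulrC.
Defined.

Lemma add_submodl M (N L : submodule M) u : N u -> add_submod N L u.
Proof. by move=> Nu; exists u => //; exists 0; [apply: submod0 | rewrite addr0]. Qed.

Lemma add_submodr M (N L : submodule M) u : L u -> add_submod N L u.
Proof. by move=> Lu; exists 0; [apply: submod0 | exists u; rewrite ?add0r]. Qed.

Lemma cyclic_submod_id M (u : M) : cyclic_submod u u.
Proof. by exists 1; rewrite scale1r. Qed.

Lemma mod_elt_sub M (N : submodule M) x u : N u -> mod_elt N x u.
Proof. by move=> Nu; exists u => //; exists 0; rewrite scaler0 addr0. Qed.

Lemma mod_elt_scale M (N : submodule M) x u : mod_elt N x (x *: u).
Proof. by exists 0; [apply: submod0 | exists u; rewrite ?add0r]. Qed.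

Definition residual M (N : submodule M) (u : M) : ideal A.
Proof.
exists (fun a : A => N (a *: u)); first by rewrite scale0r; apply: submod0.
by move=> a b c Nb Nc; rewrite scalerDl -scalerA; apply: submodZD.
Defined.

Definition preim_submod M M' (f : {linear M -> M'}) (N : submodule M') : submodule M.
Proof.
exists (fun u => N (f u)); first by rewrite linear0; apply: submod0.
by move=> a u v Nu Nv; rewrite linearP; apply: submodZD.
Defined.

Definition im_submod M M' (f : {linear M -> M'}) : submodule M'.
Proof.
exists (fun u => exists v, u = f v); first by exists 0; rewrite linear0.
by move=> a _ _ [v ->] [w ->]; exists (a *: v + w); rewrite linearP.
Defined.

Definition span M (X : set M) : submodule M.
Proof.
exists (fun u => forall P : submodule M, X `<=` P -> P u).
  by move=> P _; apply: submod0.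
by move=> a u v Pu Pv P XP; apply: submodZD; [apply: Pu | apply: Pv].
Defined.

Lemma sub_span M (X : set M) u : X u -> span X u.
Proof. by move=> Xu P; apply. Qed.

Lemma span_min M (X : set M) (P : submodule M) : X `<=` P -> span X `<=` P.
Proof. by move=> XP u; apply. Qed.

Definition noetherian_module M : Prop :=
  forall N : submodule M, exists s : seq M, N `<=>` span [set` s].

Lemma noetherian_regular : noetherian_ring A -> noetherian_module A^o.
Proof.
move=> nA N; have [n [x [Nx xN]]] := nA N; exists (codom x); split.
  move=> u /xN[c ->] P xP; apply: submod_sum => i; apply: submodZ.
  by apply: xP; apply: codom_f.
by apply: span_min => _ /codomP[i ->].
Qed.

(** Induction on a list whose span contains [N]. The coefficients of [x] in elements of [N] form an
    ideal of [A]; lifts of its generators, together with generators of the part of [N] in the span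
    of the remaining list, generate [N]. *)
Lemma noetherian_fg M : noetherian_ring A -> fg_module M -> noetherian_module M.
Proof.
move=> nA [n [x [_ gen]]].
have {gen} : forall N : submodule M, N `<=` span [set` codom x].
  move=> N u _ P xP; have [c ->] := gen u I; apply: submod_sum => i.
  by apply/submodZ/xP; apply: codom_f.
move: (codom x) => s {n x} + N; move/(_ N).
elim: s N => [|x s IHs] N Ns.
  exists [::]; split=> [|u]; first exact: Ns.
  by move=> Pu; apply: Pu => v.
pose L := span [set` s].
pose I0 (a : A) := exists2 l, L l & N (a *: x + l).
have I00 : I0 0 by exists 0; [|rewrite scale0r add0r]; apply: submod0.
have I0P (a : A) (b c : A^o) : I0 b -> I0 c -> I0 (a *: b + c).
  move=> [l Ll Nl] [l' Ll' Nl']; exists (a *: l + l'); first exact: submodZD.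
  rewrite scalerDl -scalerA addrACA -scalerDr; exact: submodZD.
have [t [It tI]] := noetherian_regular nA (Submodule I00 I0P).
have [f fP] : exists f : A^o -> M, forall a, a \in t -> L (f a) /\ N (a *: x + f a).
  suff /choice[f fP] : forall a : A^o, exists l, a \in t -> L l /\ N (a *: x + l).
    by exists f.
  move=> a.
  (* [f] matters only on [t]; elsewhere it takes the default value 0. *)
  have [/= ta|_] := boolP (a \in t); last by exists 0.
  by have [l Ll Nl] := tI a (sub_span (X := [set` t]) ta); exists l.
have [r [Nr rN]] := IHs (meet_submod N L) (fun u H => proj2 H).
pose y (a : A) := a *: x + f a.
exists ([seq y a | a <- t] ++ r); split; last first.
  apply: span_min => u /=; rewrite mem_cat => /orP[/mapP[a ta ->]|ru].
    by have [] := fP a ta.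
  by have [] := rN u (sub_span (X := [set` r]) ru).
move=> u Nu P subP.
have PNL v : N v -> L v -> P v.
  move=> Nv Lv; apply: (Nr v) => // w rw; apply: subP => /=.
  by rewrite mem_cat [w \in r]rw orbT.
(* The coefficients having a lift in [P] as well form an ideal that contains [t], hence all of
   [I0]. *)
pose K0 (a : A) := exists2 l, L l & P (a *: x + l) /\ N (a *: x + l).
have K00 : K0 0 by exists 0; [|rewrite scale0r add0r; split]; apply: submod0.
have K0P (a : A) (b c : A^o) : K0 b -> K0 c -> K0 (a *: b + c).
  move=> [l Ll [Pl Nl]] [l' Ll' [Pl' Nl']]; exists (a *: l + l'); first exact: submodZD.
  rewrite scalerDl -scalerA addrACA -scalerDr; split; exact: submodZD.
have tK : [set` t] `<=` Submodule K00 K0P.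
  move=> a ta; have [Lf Nf] := fP a ta; exists (f a) => //; split=> //.
  by apply: subP; rewrite /= mem_cat (map_f y).
have [_ [a ->] [l Ll ul]] : add_submod (cyclic_submod x) L u.
  apply: (Ns u Nu) => v; case/predU1P => [->|sv].
    exact/add_submodl/cyclic_submod_id.
  exact/add_submodr/sub_span.
have [l' Ll' [Pl' Nl']] : K0 a.
  apply: (It a) tK; exists l => //; by rewrite -ul.
have -> : u = (a *: x + l') + (l - l') by rewrite ul addrACA subrr addr0.
apply: submodD => //; apply: PNL; last exact: submodB.
have -> : l - l' = u - (a *: x + l') by rewrite ul opprD addrACA subrr add0r.
exact: submodB.
Qed.

(** Without a maximal member, choice produces a strictly ascending chain in [F]; its union is
    finitely generated, so the generators already lie in one term and the chain stops there. *)
Lemma noetherian_max M (F : submodule M -> Prop) :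
  noetherian_module M -> (exists N, F N) ->
  exists N, F N /\ forall N', F N' -> N `<=` N' -> N' `<=` N.
Proof.
move=> nM [N0 F0]; apply: contrapT => noMax.
have next N : exists N', F N -> F N' /\ N `<` N'.
  have [FN|nF] := pselect (F N); last by exists N.
  apply: contrapT => none; apply: noMax; exists N; split=> // N' F' NN'.
  by apply: contrapT => N'N; apply: none; exists N'.
have [f fP] := choice next.
pose g n := iter n f N0.
have Fg n : F (g n) by elim: n => //= n /fP[].
have gS n : g n `<` g n.+1 by have [] := fP _ (Fg n).
have gle i j : (i <= j)%N -> g i `<=` g j.
  move=> /subnK <-; elim: (j - i)%N => // n IHn u /IHn.
  by rewrite addSn; apply: (proj1 (gS _)).
have U0 : exists n, g n 0 by exists 0%N; apply: submod0.
have UP (a : A) u v : (exists n, g n u) -> (exists n, g n v) ->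
    exists n, g n (a *: u + v).
  move=> [i gu] [j gv]; exists (maxn i j).
  by apply: submodZD; [move: gu | move: gv]; apply: gle; rewrite (leq_maxl, leq_maxr).
have [s [sU Us]] := nM (Submodule U0 UP).
have [n sn] : exists n, [set` s] `<=` g n.
  have : forall u, u \in s -> exists n, g n u by move=> u su; apply/Us/sub_span.
  elim: s {sU Us} => [|x s IHs] H; first by exists 0%N.
  have [i gi] := H x (mem_head x s).
  have [|j gj] := IHs; first by move=> u su; apply: H; rewrite inE su orbT.
  exists (maxn i j) => u /=; rewrite inE => /orP[/eqP->|su].
    by move: gi; apply: gle; rewrite leq_maxl.
  by move: (gj u su); apply: gle; rewrite leq_maxr.
apply: (proj2 (gS n)) => u gu; apply: (sU u _ (g n) sn).
by exists n.+1.
Qed.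

Lemma noetherian_ind M (P : submodule M -> Prop) : noetherian_module M ->
  (forall N : submodule M, (forall N' : submodule M, N `<` N' -> P N') -> P N) ->
  forall N, P N.
Proof.
move=> nM IH N; apply: contrapT => nP.
have [L [nPL Lmax]] := noetherian_max (F := fun N => ~ P N) nM (ex_intro _ N nP).
apply/nPL/IH => L' [LL' L'L]; apply: contrapT => nPL'.
exact/L'L/Lmax.
Qed.

Lemma maximal_above (I : ideal A) : noetherian_ring A -> ~ I 1 ->
  exists2 m : ideal A, maximal_ideal m & I `<=` m.
Proof.
move=> nA I1.
have [|m [[m1 Im] mmax]] := noetherian_max
  (F := fun J : ideal A => ~ J 1 /\ I `<=` J) (noetherian_regular nA).
  by exists I; split=> // a.
exists m => //; split=> // J mJ.
have [J1|J1] := pselect (J 1); [by left|right].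
by apply: mmax => //; split=> // a /Im /mJ.
Qed.

(** Quantifying over [P] expresses that [N + J L] contains [L], without forming [J L]. If [P] is
    maximal among the submodules containing [N] but not [L], then each [u] in [L] outside [P] has a
    maximal ideal as [residual P u], so [J u] lies in [P]. *)
Lemma Nakayama M (N L : submodule M) : noetherian_module M ->
  (forall P : submodule M, N `<=` P ->
     (forall j u, jacobson A j -> L u -> P (j *: u)) -> L `<=` P) ->
  L `<=` N.
Proof.
move=> nM H; apply: contrapT => nLN.
have [|P [[NP LP] Pmax]] := noetherian_max
  (F := fun P : submodule M => N `<=` P /\ ~ L `<=` P) nM.
  by exists N; split=> // u.
apply/LP/H => // j u Jj Lu.
have [|Pu] := pselect (P u); first exact: submodZ.
apply: (Jj (residual P u)); split=> [|I PuI]; first by rewrite /= scale1r.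
have [?|nIP] := pselect (I `<=` residual P u); [by right|left].
have /existsNP[a /not_implyP[Ia Pau]] := nIP.
(* By maximality of [P] this larger submodule contains [u], which yields [b] with [1 - b a] in
   [residual P u], hence 1 in [I]. *)
pose Pa := add_submod P (cyclic_submod (a *: u)).
have LPa : L `<=` Pa.
  apply: contrapT => nL; apply/Pau/(Pmax Pa).
  - by split=> // v /NP Pv; apply: add_submodl.
  - by move=> v; apply: add_submodl.
  - exact/add_submodr/cyclic_submod_id.
have [v Pv [_ [b ->] uE]] := LPa u Lu.
have I1 : I (1 - b * a).
  by apply: PuI; rewrite /= scalerBl scale1r -scalerA {1}uE addrK.
by rewrite -[1](subrK (b * a)); apply: (submodD I1); apply: idealMl.
Qed.
End NoetherianModules.

(** * Inclusions of submodules and construction of linear maps *)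

HB.lock Definition sub_val (A : comPzRingType) (M : lmodType A) (N : submodule M) :
  {linear submod_type N -> M} := val.

Section LinearMaps.
Context {A : comPzRingType}.
Implicit Types U V W M : lmodType A.

Lemma linZ U V (f : {linear U -> V}) (a : A) u : f (a *: u) = a *: f u.
Proof. exact: linearZ. Qed.

(** Maps out of quotients and submodules are built from their graphs, which avoids computing with
    representatives. *)
Lemma linear_of_rel U V (R : U -> V -> Prop) :
  (forall u, exists v, R u v) ->
  (forall u v v', R u v -> R u v' -> v = v') ->
  (forall (a : A) u u' v v', R u v -> R u' v' -> R (a *: u + u') (a *: v + v')) ->
  exists h : {linear U -> V}, forall u, R u (h u).
Proof.
move=> /choice[f Rf] Runiq Rlin.
have linf : linear f by move=> a u v; apply: (Runiq (a *: u + v)) => //; apply: Rlin.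
pose L := GRing.isLinear.Build A U V *:%R f linf.
pose h : {linear U -> V} := HB.pack f L.
by exists h.
Qed.

Lemma factor_surj U V W (p : {linear U -> V}) (h : {linear U -> W}) :
  (forall v, exists u, v = p u) -> (forall u, p u = 0 -> h u = 0) ->
  exists g : {linear V -> W}, forall u, g (p u) = h u.
Proof.
move=> p_surj kerP.
have [||a v v' _ _ [u -> ->] [u' -> ->]|g gP] :=
  @linear_of_rel V W (fun v w => exists2 u, v = p u & w = h u).
- by move=> v; have [u ->] := p_surj v; exists (h u), u.
- move=> v _ _ [u -> ->] [u' E ->]; apply/eqP.
  by rewrite -subr_eq0 -linearB kerP // linearB E subrr.
- by exists (a *: u + u'); rewrite linearP.
exists g => u; have [u' E ->] := gP (p u); apply/eqP.
by rewrite -subr_eq0 -linearB kerP // linearB E subrr.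
Qed.

Lemma factor_inj U V W (i : {linear V -> W}) (h : {linear U -> W}) :
  injective i -> (forall u, exists v, h u = i v) ->
  exists g : {linear U -> V}, forall u, i (g u) = h u.
Proof.
move=> i_inj imP.
have [//|u v v' -> /i_inj //||g gP] := @linear_of_rel U V (fun u v => h u = i v).
  by move=> a u u' v v' E E'; rewrite !linearP E E'.
by exists g.
Qed.

Lemma inj_of_ker U V (f : {linear U -> V}) :
  (forall u, f u = 0 -> u = 0) -> injective f.
Proof.
move=> ker0 u v E; apply/eqP; rewrite -subr_eq0; apply/eqP/ker0.
by rewrite linearB E subrr.
Qed.

Lemma ker_inj U V (f : {linear U -> V}) u : injective f -> f u = 0 -> u = 0.
Proof. by move=> f_inj E; apply: f_inj; rewrite E linear0. Qed.

Lemma quot_pi_eq0 M (N : submodule M) u : quot_pi N u = 0 <-> N u.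
Proof. by rewrite -(linear0 (quot_pi N)) quot_piP subr0. Qed.

Lemma sub_valP M (N : submodule M) (u : submod_type N) : N (sub_val N u).
Proof. by rewrite sub_val.unlock; apply/asboolP/(valP u). Qed.

Lemma sub_val_ex M (N : submodule M) u : N u -> exists v, sub_val N v = u.
Proof. by move=> Nu; exists (exist _ u (asboolT Nu)); rewrite sub_val.unlock. Qed.

Lemma sub_val_inj M (N : submodule M) : injective (sub_val N).
Proof. by rewrite sub_val.unlock; apply: val_inj. Qed.

Lemma corestrict U M (N : submodule M) (h : {linear U -> M}) :
  (forall u, N (h u)) ->
  exists g : {linear U -> submod_type N}, forall u, sub_val N (g u) = h u.
Proof.
move=> Nh; apply: factor_inj => [|u]; first exact: sub_val_inj.
by have [v <-] := sub_val_ex (Nh u); exists v.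
Qed.

End LinearMaps.

(** * Injective dimension over a quotient ring and its change along a regular element *)

Section RelativeInjectiveDimension.
Context {A : comPzRingType}.
Implicit Types (U V M E Q : lmodType A) (I J : ideal A).

Definition kills I M := forall (a : A) (u : M), I a -> a *: u = 0.

(* Injectivity in the category of the A-modules killed by I, which is the
   category of A/I-modules. *)
Definition rel_injective I E : Prop :=
  kills I E /\
  forall U V (i : {linear U -> V}) (f : {linear U -> E}),
    kills I V -> injective i -> exists g : {linear V -> E}, forall u, g (i u) = f u.

(** Recursion on cosyzygies replaces a resolution indexed by degrees, so that the arguments below
    are inductions on [n]. *)
Fixpoint rel_injdim_le I n M : Prop :=
  if n is n'.+1 then
    exists E M' (f : {linear M -> E}) (g : {linear E -> M'}),
      [/\ rel_injective I E, injective f, exact_at f g,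
          (forall w, exists e, w = g e) & rel_injdim_le I n' M']
  else rel_injective I M.

Definition divisible_by (x : A) M := forall u : M, exists v, u = x *: v.

Definition torsion_submod (x : A) M : submodule M.
Proof.
exists (fun u => x *: u = 0); first by rewrite scaler0.
by move=> a u v xu xv; rewrite scalerDr xv addr0 scalerA mulrC -scalerA xu scaler0.
Defined.

Local Notation torsion x M := (submod_type (torsion_submod x M)).

Lemma torsionP x M (u : torsion x M) : x *: sub_val _ u = 0.
Proof. exact: (sub_valP u). Qed.

Lemma kills_surj I U V (p : {linear U -> V}) :
  (forall v, exists u, v = p u) -> kills I U -> kills I V.
Proof.
by move=> p_surj IU a v Ia; have [u ->] := p_surj v; rewrite -linZ IU ?linear0.
Qed.

Lemma kills_inj I U V (i : {linear U -> V}) : injective i -> kills I V -> kills I U.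
Proof. by move=> i_inj IV a u Ia; apply: i_inj; rewrite linZ IV ?linear0. Qed.

Lemma rel_injective_iso I U V (f : {linear U -> V}) :
  injective f -> (forall v, exists u, v = f u) ->
  rel_injective I V -> rel_injective I U.
Proof.
move=> f_inj f_surj [IV extV]; split=> [|P R i h IR i_inj]; first exact: kills_inj f_inj IV.
have [h' h'P] : exists h' : {linear P -> V}, forall u, h' u = f (h u) by exists (f \o h).
have [g gP] := extV _ _ i h' IR i_inj.
have [|k kP] := @factor_inj _ _ _ _ f g f_inj; first by move=> u; apply: f_surj.
by exists k => u; apply: f_inj; rewrite kP gP h'P.
Qed.

(** A retraction [r] of [h] exists because [E0] is injective; then [e - h (r e)] induces a section
    of [p], and [Q] is a direct summand of [E]. *)
Lemma rel_injective_quot I E0 E Q (h : {linear E0 -> E}) (p : {linear E -> Q}) :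
  injective h -> exact_at h p -> (forall q, exists e, q = p e) ->
  rel_injective I E0 -> rel_injective I E -> rel_injective I Q.
Proof.
move=> h_inj ex p_surj [IE0 ext0] [IE ext].
split=> [|U V i f IV i_inj]; first exact: kills_surj p_surj IE.
have [r rP] := ext0 _ _ h idfun IE h_inj.
have [s0 s0P] : exists s0 : {linear E -> E}, forall e, s0 e = e - h (r e).
  by exists (idfun \- (h \o r)).
have [|s sP] := @factor_surj _ _ _ _ p s0 p_surj.
  by move=> e /ex[v ->]; rewrite s0P rP subrr.
have ps q : p (s q) = q.
  have [e ->] := p_surj q; rewrite sP s0P linearB.
  have -> : p (h (r e)) = 0 by apply/ex; exists (r e).
  by rewrite subr0.
have [g gP] := ext _ _ i (s \o f) IV i_inj.
by exists (p \o g) => u /=; rewrite gP /= ps.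
Qed.

(* If 0 -> E0 -> M -> Q -> 0 is exact and E0 is injective, the sequence splits,
   so Q inherits bounds on the injective dimension. *)
Lemma rel_injdim_quot I n E0 M Q (h : {linear E0 -> M}) (p : {linear M -> Q}) :
  injective h -> exact_at h p -> (forall q, exists e, q = p e) ->
  rel_injective I E0 -> rel_injdim_le I n M -> rel_injdim_le I n Q.
Proof.
case: n => [|n] h_inj ex p_surj inj0 /=; first exact: rel_injective_quot ex p_surj inj0.
move=> [E [M' [f [g [injE f_inj fg_ex g_surj dimM']]]]].
(* Dividing [E] by the image of [E0] keeps it injective, embeds [Q] in it and leaves the cokernel
   [M'] unchanged. *)
pose K := im_submod (f \o h).
have [|f' f'P] := @factor_surj _ _ _ _ p (quot_pi K \o f) p_surj.
  by move=> u /ex[v ->] /=; apply/quot_pi_eq0; exists v.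
have [||g' g'P] := @factor_surj _ _ _ _ (quot_pi K) g.
- exact: quot_pi_surj.
- by move=> e /quot_pi_eq0[v ->] /=; apply/fg_ex; exists (h v).
exists (quot_module K), M', f', g'; split=> //.
- apply: (@rel_injective_quot I E0 E _ (f \o h) (quot_pi K)) => //.
  + by move=> u v /f_inj/h_inj.
  + by move=> v; rewrite quot_pi_eq0.
  + exact: quot_pi_surj.
- apply: inj_of_ker => q; have [u ->] := p_surj q; rewrite f'P /=.
  move=> /quot_pi_eq0[v /f_inj ->].
  by apply/ex; exists v.
- move=> q; have [e ->] := quot_pi_surj q; rewrite g'P; split.
    by move=> /fg_ex[u ->]; exists (p u); rewrite f'P.
  move=> [q' ]; have [u ->] := p_surj q'; rewrite f'P => /quot_piP[v /=].
  move/(canRL (subrK _)) ->; apply/fg_ex; exists (h v + u); by rewrite linearD.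
- by move=> w; have [e ->] := g_surj w; exists (quot_pi K e); rewrite g'P.
Qed.

(** Multiplication by [x] is injective on [A/I], so the map from [A/I] to [E] sending 1 to [u]
    extends along it; the extension sends 1 to an element [v] with [x v = u]. *)
Lemma rel_injective_divisible I (x : A) E :
  (forall b : A, I (x * b) -> I b) -> rel_injective I E -> divisible_by x E.
Proof.
move=> x_reg [IE ext] u; pose R := quot_module I.
have pi_surj := @quot_pi_surj A A^o I.
have IR : kills I R.
  move=> a r Ia; have [b ->] := pi_surj r; rewrite -linZ; apply/quot_pi_eq0.
  exact: (idealMr (I := I)).
have [|i iP] := @factor_surj _ _ _ _ (quot_pi I) (x \*: quot_pi I) pi_surj.
  move=> b /quot_pi_eq0 Ib /=; rewrite -linZ; apply/quot_pi_eq0.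
  exact: submodZ.
have [h hP] : exists h : {linear A^o -> E}, forall b : A, h b = b *: u.
  have [|b ? ? -> ->|a b c _ _ -> ->|h hP] :=
    @linear_of_rel _ A^o E (fun b v => v = (b : A) *: u).
  - by move=> b; exists (b *: u).
  - by [].
  - by rewrite scalerDl scalerA.
  by exists h.
have [|f fP] := @factor_surj _ _ _ _ (quot_pi I) h pi_surj.
  by move=> b /quot_pi_eq0 Ib; rewrite hP IE.
have [|g gP] := ext _ _ i f IR.
  apply: inj_of_ker => r; have [b ->] := pi_surj r; rewrite iP /= -linZ.
  by move=> /quot_pi_eq0/x_reg Ib; apply/quot_pi_eq0.
exists (g (quot_pi I 1)); rewrite -linZ.
by have := gP (quot_pi I 1); rewrite iP /= => ->; rewrite fP hP scale1r.
Qed.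

Lemma kills_mod_elt I x M : kills I M -> (forall u : M, x *: u = 0) ->
  kills (mod_elt I x) M.
Proof.
move=> IM xM _ u [a Ia [b ->]]; rewrite scalerDl IM // add0r.
by rewrite -[x *: b]/(x * b) mulrC -scalerA xM scaler0.
Qed.

Lemma kills_mod_eltl I x M : kills (mod_elt I x) M -> kills I M.
Proof. by move=> IM a u Ia; apply/IM/mod_elt_sub. Qed.

(** A map into [E] from a module killed by [I + (x)] lands in the [x]-torsion of [E]. *)
Lemma rel_injective_torsion I (x : A) E :
  rel_injective I E -> rel_injective (mod_elt I x) (torsion x E).
Proof.
move=> [IE ext]; split=> [|U V i f IV i_inj].
  apply: kills_mod_elt => [|u]; first exact: kills_inj (@sub_val_inj _ _ _) IE.
  by apply: sub_val_inj; rewrite linZ torsionP linear0.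
have [||g gP] := ext _ _ i (sub_val _ \o f).
- exact: kills_mod_eltl IV.
- exact: i_inj.
have [|g' g'P] := @corestrict _ _ _ (torsion_submod x E) g.
  move=> v /=; rewrite -linZ IV ?linear0 //.
  by have := mod_elt_scale I x (1 : A); rewrite /GRing.scale /= mulr1.
by exists g' => u; apply: sub_val_inj; rewrite g'P gP.
Qed.

Lemma torsion_map (x : A) U V (f : {linear U -> V}) :
  exists fx : {linear torsion x U -> torsion x V},
    forall u, sub_val _ (fx u) = f (sub_val _ u).
Proof.
apply: (corestrict (h := f \o sub_val _)) => u /=.
by rewrite -linZ torsionP linear0.
Qed.

Lemma divisible_surj x U V (p : {linear U -> V}) :
  (forall v, exists u, v = p u) -> divisible_by x U -> divisible_by x V.
Proof.
move=> p_surj xU v; have [u ->] := p_surj v; have [u' ->] := xU u.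
by exists (p u'); rewrite linZ.
Qed.

(** As [M = x M], the snake lemma has no connecting term, and taking [x]-torsion keeps the sequence
    of [M], [E], [M'] exact. *)
Lemma rel_injdim_torsion I (x : A) n M :
  (forall b : A, I (x * b) -> I b) -> divisible_by x M ->
  rel_injdim_le I n M -> rel_injdim_le (mod_elt I x) n (torsion x M).
Proof.
move=> x_reg; elim: n M => [|n IHn] M xM /=; first exact: rel_injective_torsion.
move=> [E [M' [f [g [injE f_inj ex g_surj dimM']]]]].
have [fx fxP] := torsion_map x f; have [gx gxP] := torsion_map x g.
have xE := rel_injective_divisible x_reg injE.
exists (torsion x E), (torsion x M'), fx, gx; split.
- exact: rel_injective_torsion.
- move=> u v /(congr1 (sub_val _)); rewrite !fxP => /f_inj; exact: sub_val_inj.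
- move=> e; split=> [/(congr1 (sub_val _))|[u ->]].
    rewrite gxP linear0 => /ex[u eu].
    have [|u' u'E] := @sub_val_ex _ _ (torsion_submod x M) u.
      by apply: f_inj; rewrite linZ -eu torsionP linear0.
    by exists u'; apply: sub_val_inj; rewrite fxP u'E.
  by apply: sub_val_inj; rewrite gxP fxP linear0; apply/ex; exists (sub_val _ u).
- move=> w; have [e we] := g_surj (sub_val _ w).
  have [|u ue] := (proj1 (ex (x *: e))); first by rewrite linZ -we torsionP.
  have [v uv] := xM u.
  have [|e' e'E] := @sub_val_ex _ _ (torsion_submod x E) (e - f v).
    by rewrite /= scalerBr ue uv linZ subrr.
  exists e'; apply: sub_val_inj; rewrite gxP e'E linearB -we.
  have -> : g (f v) = 0 by apply/ex; exists v.
  by rewrite subr0.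
- by apply: IHn => //; apply: divisible_surj xE.
Qed.

(* Rees: the snake lemma for x on 0 -> M -> E -> M' -> 0 gives
   0 -> E_x -> M'_x -> M/xM -> 0, where E_x and M'_x are the x-torsion parts. *)
Lemma rel_injdim_mod_elt I (x : A) n M Q (p : {linear M -> Q}) :
  (forall b : A, I (x * b) -> I b) -> (forall u : M, x *: u = 0 -> u = 0) ->
  (forall q, exists u, q = p u) -> (forall u, p u = 0 <-> exists v, u = x *: v) ->
  rel_injdim_le I n.+1 M -> rel_injdim_le (mod_elt I x) n Q.
Proof.
move=> x_reg xM p_surj kerp [E [M' [f [g [injE f_inj ex g_surj dimM']]]]].
have xE := rel_injective_divisible x_reg injE.
have gf v : g (f v) = 0 by apply/ex; exists v.
have dimT : rel_injdim_le (mod_elt I x) n (torsion x M').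
  by apply: rel_injdim_torsion => //; apply: divisible_surj xE.
have [h hP] := torsion_map x g.
(* The connecting map [d] is defined on [P]: for [e] with [x g(e) = 0], write [x e = f(psi e)] and
   send [g e] to the class [p (psi e)]. *)
pose P := submod_type (preim_submod g (torsion_submod x M')).
have [|psi psiP] := @factor_inj _ P _ _ f (x \*: sub_val _) f_inj.
  by move=> e; apply/ex; rewrite /= linZ; apply: (sub_valP e).
have [|gP gPE] := @corestrict _ P _ (torsion_submod x M') (g \o sub_val _).
  by move=> e; apply: (sub_valP e).
have gP_surj w : exists e, w = gP e.
  have [e we] := g_surj (sub_val _ w).
  have [|e' e'E] := @sub_val_ex _ _ (preim_submod g (torsion_submod x M')) e.
    by rewrite /= -we torsionP.
  by exists e'; apply: sub_val_inj; rewrite gPE /= e'E.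
have [|d dP] := @factor_surj _ _ _ _ gP (p \o psi) gP_surj.
  move=> e /(congr1 (sub_val _)); rewrite gPE linear0 /= => /ex[v ev].
  by apply/kerp; exists v; apply: f_inj; rewrite psiP /= ev linZ.
(* [Q] is the quotient of the torsion of [M'] by the injective torsion of [E]; what remains is the
   exactness of the snake. *)
apply: (rel_injdim_quot (h := h) (p := d) _ _ _ (rel_injective_torsion x injE) dimT).
- apply: inj_of_ker => e /(congr1 (sub_val _)); rewrite hP linear0 => /ex[v ev].
  apply: sub_val_inj; rewrite ev linear0 (xM v) ?linear0 //.
  by apply: f_inj; rewrite linZ -ev torsionP linear0.
- move=> w; have [e ->] := gP_surj w; rewrite dP /=; split.
    move=> /kerp[v psiv].
    have [|e' e'E] := @sub_val_ex _ _ (torsion_submod x E) (sub_val _ e - f v).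
      by rewrite /= scalerBr -[x *: sub_val _ _]psiP psiv linZ subrr.
    by exists e'; apply: sub_val_inj; rewrite hP gPE e'E linearB gf subr0.
  move=> [e' /(congr1 (sub_val _))]; rewrite gPE hP /= => E1.
  have [v ev] : exists v, sub_val _ e - sub_val _ e' = f v.
    by apply/ex; rewrite linearB E1 subrr.
  apply/kerp; exists v; apply: f_inj; rewrite psiP /= linZ -ev scalerBr.
  by rewrite torsionP subr0.
- move=> q; have [u ->] := p_surj q; have [e ue] := xE (f u).
  have [|e' e'E] := @sub_val_ex _ _ (preim_submod g (torsion_submod x M')) e.
    by rewrite /= -linZ -ue gf.
  exists (gP e'); rewrite dP /=; congr (p _); apply: f_inj.
  by rewrite psiP /= e'E.
Qed.

End RelativeInjectiveDimension.

(** * Associated primes and prime avoidance *)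

Section AssociatedPrimes.
Context {A : comPzRingType}.
Implicit Types (M : lmodType A) (I J p : ideal A).

(** [residual N u] is the annihilator of the class of [u] in [M/N]; the maximal annihilators of
    nonzero classes are associated primes of [M/N]. *)
Definition maximal_residual M (N : submodule M) (u : M) :=
  ~ N u /\ forall v, ~ N v -> residual N u `<=` residual N v ->
    residual N v `<=` residual N u.

(** If [a b] kills the class of [u] but [b] does not, then [b u] has a larger annihilator, equal to
    the first by maximality, and it contains [a]. *)
Lemma maximal_residual_prime M (N : submodule M) u :
  maximal_residual N u -> prime_ideal (residual N u).
Proof.
move=> [Nu umax]; split=> [|a b /= abu]; first by rewrite /= scale1r.
have [|bu] := pselect (N (b *: u)); [by right|left].
apply: (umax (b *: u)) => //=; last by rewrite scalerA.
by move=> c /= cu; rewrite scalerA mulrC -scalerA; apply: submodZ.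
Qed.

Lemma maximal_residual_ex M (N : submodule M) u : noetherian_ring A -> ~ N u ->
  exists v, maximal_residual N v /\ residual N u `<=` residual N v.
Proof.
move=> nA Nu.
have [|J [[v [Nv uv vJ]] Jmax]] := noetherian_max
  (F := fun J : ideal A => exists v, [/\ ~ N v, residual N u `<=` J & J = residual N v])
  (noetherian_regular nA).
  by exists (residual N u), u; split=> // a.
subst J; exists v; split=> //; split=> // w Nw vw.
apply: Jmax => //; exists w; split=> // a /uv; exact: vw.
Qed.

Lemma prime_avoid_list p (qs : list (ideal A)) : prime_ideal p ->
  (forall q, List.In q qs -> ~ q `<=` p) ->
  exists2 y, ~ p y & forall q, List.In q qs -> q y.
Proof.
move=> [p1 pP]; elim: qs => [|q qs IHqs] H; first by exists 1.
have [|y py qy] := IHqs; first by move=> r rqs; apply: H; right.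
have /existsNP[z /not_implyP[qz pz]] := H q (or_introl erefl).
exists (z * y) => [/pP[]|r [<-|rqs]] //; first exact: idealMr.
exact/idealMl/qy.
Qed.

(** Induction on the number of primes. If the element [x] found for the others lies in [p], it is
    corrected by [z y] with [z] in [I] outside [p], and [y] outside [p] but in every other prime
    kept. *)
Lemma prime_avoidance I (ps : list (ideal A)) :
  (forall p, List.In p ps -> prime_ideal p /\ ~ I `<=` p) ->
  exists2 x, I x & forall p, List.In p ps -> ~ p x.
Proof.
have [n] := ubnP (length ps); elim: n ps => // n IHn [|p ps] /= lt_n H.
  by exists 0; first exact: submod0.
(* Primes inside [p] are dropped, since avoiding [p] avoids them too. *)
pose qs := List.filter (fun q : ideal A => ~~ `[< q `<=` p >]) ps.
have qsP q : List.In q qs <-> List.In q ps /\ ~ q `<=` p.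
  by rewrite /qs List.filter_In; split=> -[? H']; split=> //; apply/asboolPn.
have [||x Ix qx] := IHn qs.
- rewrite ltnS in lt_n; apply: leq_ltn_trans lt_n; apply/leP; exact: List.filter_length_le.
- by move=> q /qsP[qps _]; apply: H; right.
have [pP /existsNP[z /not_implyP[Iz pz]]] := H p (or_introl erefl).
have [px|px] := pselect (p x); last first.
  exists x => // q [<-//|qps]; have [qp /qp //|qp] := pselect (q `<=` p).
  by apply: qx; apply/qsP.
have [y py qy] := prime_avoid_list pP (fun q qqs => proj2 (proj1 (qsP q) qqs)).
have pxy : ~ p (x + z * y).
  move=> pxy; have /(proj2 pP)[] // : p (z * y).
  by rewrite -[z * y](addKr x); apply: submodD => //; apply: submodN.
exists (x + z * y); first by apply: submodD => //; apply: idealMr.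
move=> q [<-//|qps]; have [qp /qp //|qp] := pselect (q `<=` p).
have qqs : List.In q qs by apply/qsP.
move=> qxy; apply: (qx q qqs); rewrite -[x](addrK (z * y)); apply: submodB => //.
exact/idealMl/qy.
Qed.

Lemma In_mem (T : eqType) (x : T) s : List.In x s <-> x \in s.
Proof.
elim: s => //= y s IHs; rewrite inE eq_sym; split=> [[->|/IHs->]|/predU1P[]].
- by rewrite eqxx.
- by rewrite orbT.
- by move=> ->; left.
- by move/IHs; right.
Qed.

(** Choose finitely many [us] with maximal residuals and largest possible span. Any further such [v]
    lies in this span, so what kills all of [us] modulo [N] kills [v]; by primality some residual of
    [us] is inside that of [v], hence equal to it. *)
Lemma zero_divisor_primes M (N : submodule M) :
  noetherian_ring A -> noetherian_module M ->
  exists ps : list (ideal A),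
    (forall p, List.In p ps ->
       prime_ideal p /\ exists2 u, ~ N u & p `<=>` residual N u) /\
    (forall (a : A) u, ~ N u -> N (a *: u) -> exists2 p, List.In p ps & p a).
Proof.
move=> nA nM.
have [|L [[us [usm LE]] Lmax]] := noetherian_max
  (F := fun L : submodule M => exists us : seq M,
     (forall u, u \in us -> maximal_residual N u) /\ L = span [set` us]) nM.
  by exists (span [set` [::]]), [::].
exists (List.map (residual N) us).
split=> [p /List.in_map_iff[u [<- /In_mem uus]]|a u Nu au].
  split; first exact/maximal_residual_prime/usm.
  by exists u; [have [] := usm u uus|split].
have [v [vmax uv]] := maximal_residual_ex nA Nu.
have Lv : L v.
  apply: (Lmax (span [set` v :: us])).
  - exists (v :: us); split=> // w; case/predU1P => [->//|]; exact: usm.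
  - rewrite LE; apply: span_min => w wus; apply: sub_span.
    by rewrite /= inE [w \in us]wus orbT.
  - by apply: sub_span; rewrite /= inE eqxx.
apply: contrapT => nex.
have [q qus|y vy usy] := prime_avoid_list (maximal_residual_prime vmax)
  (qs := List.map (residual N) us).
  move=> qv; apply: nex; exists q => //.
  have /List.in_map_iff[w [qE /In_mem wus]] := qus; subst q.
  apply: (proj2 (usm w wus) v (proj1 vmax) qv); exact: uv.
apply: vy; move: Lv; rewrite LE => /(_ (preim_submod ((y : A) \*: @idfun M) N)); apply.
by move=> w wus; apply: (usy (residual N w)); apply: List.in_map; apply/In_mem.
Qed.

End AssociatedPrimes.

(** * Regular sequences and the exchange of their elements *)

Section RegularSequences.
Context {A : comPzRingType}.
Implicit Types (M : lmodType A) (I J p m : ideal A).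

Definition regular_on M (N : submodule M) (x : A) := forall u, N (x *: u) -> N u.

(* Unlike in [regular_seq], M/N is not required to be nonzero. *)
Fixpoint depth_ge m d M (N : submodule M) : Prop :=
  if d is d'.+1 then
    exists x, [/\ m x, regular_on N x & depth_ge m d' (mod_elt N x)]
  else True.

(** This is the vanishing of [Hom(A/m, M/N)]. In the Noetherian setting it amounts to the existence
    of a regular element in [m], and it passes easily from one quotient to another. *)
Definition socle_free m M (N : submodule M) :=
  forall u, (forall a : A, m a -> N (a *: u)) -> N u.

Lemma regular_socle_free m M (N : submodule M) x :
  m x -> regular_on N x -> socle_free m N.
Proof. by move=> mx xreg u mu; apply/xreg/mu. Qed.

(** An associated prime containing [m] would provide a nonzero socle class. Returning a list of
    primes lets several modules be avoided at once. *)
Lemma socle_free_primes m M (N : submodule M) :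
  noetherian_ring A -> noetherian_module M -> socle_free m N ->
  exists ps : list (ideal A),
    (forall p, List.In p ps -> prime_ideal p /\ ~ m `<=` p) /\
    (forall x : A, (forall p, List.In p ps -> ~ p x) -> regular_on N x).
Proof.
move=> nA nM socN; have [ps [psP psz]] := zero_divisor_primes N nA nM.
exists ps; split=> [p pps|x xps u xu].
  have [pP [u Nu [pu _]]] := psP p pps; split=> // mp; apply/Nu/socN => a ma.
  exact/pu/mp.
by apply: contrapT => Nu; have [p /xps] := psz x u Nu xu.
Qed.

Lemma eq_depth_ge m d M (N N' : submodule M) :
  (forall u, N u <-> N' u) -> depth_ge m d N -> depth_ge m d N'.
Proof.
elim: d N N' => [|d IHd] N N' NN' //= [x [mx xreg dN]]; exists x; split=> //.
  by move=> u /NN' /xreg /NN'.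
apply: IHd dN => u; split=> -[v /NN' Nv [w ->]]; exists v => //; by exists w.
Qed.

Lemma mod_eltC M (N : submodule M) x y u :
  mod_elt (mod_elt N x) y u -> mod_elt (mod_elt N y) x u.
Proof.
move=> [_ [v Nv [w ->]] [w' ->]]; exists (v + y *: w'); last by exists w; rewrite addrAC.
by exists v => //; exists w'.
Qed.

(** From [y u = n + z v], regularity of [z] gives [v = n' + y v'], so [y (u - z v')] lies in [N]. *)
Lemma regular_swap M (N : submodule M) y z :
  regular_on N y -> regular_on (mod_elt N y) z -> regular_on (mod_elt N z) y.
Proof.
move=> yreg zreg u [n Nn [v yu]].
have [|n' Nn' [v' vE]] := zreg v.
  by exists (- n); [exact: submodN | exists u; rewrite yu addKr].
exists (u - z *: v'); last by exists v'; rewrite subrK.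
apply: yreg; rewrite scalerBr yu vE !scalerDr !scalerA [z * y]mulrC addrA addrK.
by apply: submodD => //; apply: submodZ.
Qed.

(* If a multiplies u into N + x M, then writing y u = n + x v moves the socle
   element u of M/(N + x M) to the socle element v of M/(N + y M). *)
Lemma socle_free_exchange m M (N : submodule M) x y :
  m y -> regular_on N x -> regular_on N y -> socle_free m (mod_elt N y) ->
  socle_free m (mod_elt N x).
Proof.
move=> my xreg yreg ysoc u mu; have [n Nn [v yu]] := mu y my.
have [a ma|n' Nn' [v' vE]] := ysoc v.
  have [k Nk [w au]] := mu a ma.
  exists (a *: v - y *: w); last by exists w; rewrite subrK.
  apply: xreg; rewrite scalerBr.
  have -> : x *: (a *: v) = a *: (y *: u - n).
    by rewrite yu [n + _]addrC addrK !scalerA mulrC.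
  rewrite scalerBr scalerA mulrC -scalerA au scalerDr !scalerA [y * x]mulrC.
  rewrite addrAC addrK; apply: submodB; exact: submodZ.
exists (u - x *: v'); last by exists v'; rewrite subrK.
apply: yreg; rewrite scalerBr yu vE !scalerDr !scalerA [x * y]mulrC addrA addrK.
by apply: submodD => //; apply: submodZ.
Qed.

(** An auxiliary [z] regular modulo [N], [N + y M] and [N + x M] links the two sequences: induction
    handles [z] modulo [N + y M], swapping makes [y] the first element modulo [N + z M], and
    induction then replaces [y] by [x]. *)
Lemma depth_ge_exchange m d M (N : submodule M) x :
  noetherian_ring A -> noetherian_module M ->
  depth_ge m d.+1 N -> m x -> regular_on N x -> depth_ge m d (mod_elt N x).
Proof.
move=> nA nM; elim: d N x => [//|d IHd] N x [y [my yreg dNy]] mx xreg.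
have [y' [my' y'reg _]] := dNy.
have ysoc := regular_socle_free my' y'reg.
have [ps [psP psreg]] := socle_free_primes nA nM (regular_socle_free mx xreg).
have [qs [qsP qsreg]] := socle_free_primes nA nM ysoc.
have [rs [rsP rsreg]] := socle_free_primes nA nM (socle_free_exchange my xreg yreg ysoc).
have [|z mz zP] := @prime_avoidance A m (ps ++ qs ++ rs)%list.
  by move=> p /List.in_app_iff[/psP|/List.in_app_iff[/qsP|/rsP]].
have zreg : regular_on N z.
  by apply: psreg => p pps; apply: zP; apply/List.in_app_iff; left.
have zyreg : regular_on (mod_elt N y) z.
  by apply: qsreg => p pps; apply: zP; apply/List.in_app_iff; right;
    apply/List.in_app_iff; left.
have zxreg : regular_on (mod_elt N x) z.
  by apply: rsreg => p pps; apply: zP; apply/List.in_app_iff; right;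
    apply/List.in_app_iff; right.
exists z; split=> //.
have dNz : depth_ge m d.+1 (mod_elt N z).
  exists y; split=> //; first exact: regular_swap.
  by apply: eq_depth_ge (IHd _ _ dNy mz zyreg) => u; split; apply: mod_eltC.
apply: eq_depth_ge (IHd _ _ dNz mx (regular_swap xreg zxreg)) => u.
by split; apply: mod_eltC.
Qed.

(** Avoiding the associated primes of both quotients gives a common regular element; exchange lets
    it start both sequences. *)
Lemma depth_ge_regular m d M M' (N : submodule M) (N' : submodule M') :
  noetherian_ring A -> noetherian_module M -> noetherian_module M' ->
  depth_ge m d.+1 N -> depth_ge m d.+1 N' ->
  exists x, [/\ m x, regular_on N x /\ regular_on N' x,
    depth_ge m d (mod_elt N x) & depth_ge m d (mod_elt N' x)].
Proof.
move=> nA nM nM' dN dN'; have [y [my yreg _]] := dN; have [y' [my' y'reg _]] := dN'.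
have [ps [psP psreg]] := socle_free_primes nA nM (regular_socle_free my yreg).
have [qs [qsP qsreg]] := socle_free_primes nA nM' (regular_socle_free my' y'reg).
have [|x mx xP] := @prime_avoidance A m (ps ++ qs)%list.
  by move=> p /List.in_app_iff[/psP|/qsP].
have xreg : regular_on N x.
  by apply: psreg => p pps; apply: xP; apply/List.in_app_iff; left.
have xreg' : regular_on N' x.
  by apply: qsreg => p pps; apply: xP; apply/List.in_app_iff; right.
by exists x; split=> //; apply: depth_ge_exchange.
Qed.

Lemma seq_mul_nat M (s : seq A) (u : M) :
  seq_mul s u <-> exists f : nat -> M, u = \sum_(0 <= i < size s) s`_i *: f i.
Proof.
split=> [[x ->]|[f ->]]; last by exists (fun i => f i); rewrite big_mkord.
exists (fun i => if insub i is Some j then x j else 0).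
by rewrite big_mkord; apply: eq_bigr => i _; rewrite valK.
Qed.

Lemma seq_mul_rcons M (s : seq A) x (u : M) :
  seq_mul (rcons s x) u <-> exists2 v, seq_mul s v & exists w, u = v + x *: w.
Proof.
split=> [/seq_mul_nat[f ->]|[v /seq_mul_nat[f ->] [w ->]]].
  rewrite size_rcons big_nat_recr //= nth_rcons ltnn eqxx.
  exists (\sum_(0 <= i < size s) s`_i *: f i); first by apply/seq_mul_nat; exists f.
  exists (f (size s)); congr (_ + _); rewrite !big_mkord; apply: eq_bigr => i _.
  by rewrite nth_rcons ltn_ord.
apply/seq_mul_nat; exists (fun i => if i == size s then w else f i).
rewrite size_rcons big_nat_recr //= nth_rcons ltnn eqxx; congr (_ + _).
rewrite !big_mkord; apply: eq_bigr => i _.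
by rewrite nth_rcons ltn_ord ltn_eqF.
Qed.

Lemma regular_seq_in_depth_ge m M d :
  regular_seq_in m M d -> depth_ge m d (zero_submod M).
Proof.
move=> [s [<- ms [sreg _]]].
(* Here [i] elements are already divided out and [k] remain. *)
have step k i (N : submodule M) : (k + i = size s)%N ->
    (forall u, N u <-> seq_mul (take i s) u) -> depth_ge m k N.
  elim: k i N => [//|k IHk] i N kE NE.
  have lt_is : (i < size s)%N by rewrite -kE addSn ltnS leq_addl.
  exists s`_i; split; first exact/ms/mem_nth.
    by move=> u /NE /(sreg i lt_is) /NE.
  apply: (IHk i.+1) => [|u]; first by rewrite addnS -addSn.
  rewrite (take_nth 0 lt_is); split=> [[v /NE Nv uE]|].
    by apply/seq_mul_rcons; exists v.
  by move/seq_mul_rcons => [v /NE Nv uE]; exists v.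
apply: (step _ 0%N) => [|u]; first by rewrite addn0.
rewrite take0; split=> [->|[x ->]]; last by rewrite big_ord0.
by exists (fun=> 0); rewrite big_ord0.
Qed.

Lemma regular_seq_in_nonzero m M d : regular_seq_in m M d -> exists u : M, u <> 0.
Proof.
move=> [s [_ _ [_ sT]]]; apply: contrapT => none; apply: sT.
rewrite -subTset => u _; exists (fun=> 0).
apply: contrapT => u0; apply: none; exists u => uE; apply: u0.
by rewrite uE big1 // => i; rewrite scaler0.
Qed.

End RegularSequences.

(** * Prime chains and regular elements *)

Section PrimeChains.
Context {A : comPzRingType}.
Implicit Types (I p q : ideal A).

(** The products [x^n s] with [s] outside [p] form a multiplicative set, disjoint from [I] because
    [x] is regular. An ideal over [I] maximal among those disjoint from it is prime, lies in [p] and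
    omits [x]. *)
Lemma prime_below_regular I p x : noetherian_ring A ->
  prime_ideal p -> I `<=` p -> p x -> regular_on I x ->
  exists q : ideal A, [/\ prime_ideal q, I `<=` q & q `<` p].
Proof.
move=> nA [p1 pP] Ip px xreg.
pose S a := exists n s, ~ p s /\ a = x ^+ n * s.
have SM a b : S a -> S b -> S (a * b).
  move=> [n [s [ps ->]]] [k [t [pt ->]]]; exists (n + k)%N, (s * t).
  by split; [case/pP | rewrite exprD; ring].
have [|q [[Iq qS] qmax]] := noetherian_max
  (F := fun J : ideal A => I `<=` J /\ forall a, J a -> ~ S a) (noetherian_regular nA).
  exists I; split=> [//|a Ia [n [s [ps E]]]]; subst a; apply/ps/Ip.
  elim: n Ia => [|n IHn]; first by rewrite expr0 mul1r.
  by rewrite exprS -mulrA => /xreg/IHn.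
have meetS a : ~ q a -> exists2 b, S b & exists2 c, q c & exists d, b = c + d * a.
  move=> qa; apply: contrapT => none; apply: qa.
  apply: (qmax (add_submod q (cyclic_submod (a : A^o)))).
  - split=> [b /Iq qb|_ [c qc [_ [d ->] ->]] Sb]; first exact: add_submodl.
    by apply: none; exists (c + d * a) => //; exists c => //; exists d.
  - by move=> b; apply: add_submodl.
  - exact/add_submodr/cyclic_submod_id.
exists q; split=> //.
  split=> [q1|a b qab].
    by apply: (qS 1) => //; exists 0%N, 1; rewrite expr0 mulr1.
  have [|qa] := pselect (q a); [by left|right].
  apply: contrapT => qb.
  have [s Ss [c qc [d sE]]] := meetS a qa; have [t St [e qe [f tE]]] := meetS b qb.
  apply: (qS (s * t)); last exact: SM.
  have -> : s * t = t * c + (d * a) * e + d * f * (a * b) by rewrite sE tE; ring.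
  by do 2?[apply: submodD]; apply: idealMl.
split=> [a qa|pq].
  by apply: contrapT => pa; apply: (qS a) => //; exists 0%N, a; rewrite expr0 mul1r.
by apply: (qS x); [exact: pq | exists 1%N, 1; rewrite expr1 mulr1].
Qed.

(** The least prime of the chain contains [x], so another prime over [I] fits strictly below it. *)
Lemma prime_chain_mod_elt I x d : noetherian_ring A -> regular_on I x ->
  @prime_chain A (mod_elt I x) d -> @prime_chain A I d.+1.
Proof.
move=> nA xreg [p [pP plt]].
have [p0P Ip0] := pP 0%N (leq0n d).
have [||q [qP Iq qp0]] := prime_below_regular nA p0P _ _ xreg.
- by move=> a Ia; apply/Ip0/mod_elt_sub.
- by apply: Ip0; have := mod_elt_scale I x (1 : A); rewrite /GRing.scale /= mulr1.
exists (fun i => if i is i'.+1 then p i' else q); split=> -[|i] //= lt_id.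
- have [piP Ipi] := pP i lt_id; split=> // a Ia; exact/Ipi/mod_elt_sub.
- exact: plt.
Qed.

End PrimeChains.

(** * Faithfulness of modules of finite injective dimension over a local ring *)

Section LocalRing.
Context {A : comPzRingType}.
Variables (m : ideal A) (nA : noetherian_ring A) (locA : local_ring m).
Implicit Types (M E Q : lmodType A) (I J p : ideal A).

Lemma proper_sub_maximal J : ~ J 1 -> J `<=` m.
Proof.
move=> /(maximal_above nA)[m' m'max Jm'].
by rewrite -(proj2 locA m' m'max).
Qed.

Lemma maximal_jacobson : m `<=` jacobson A.
Proof. by move=> a ma m' m'max; rewrite (proj2 locA m' m'max). Qed.

Lemma Nakayama_elt M (N : submodule M) x u : noetherian_module M -> m x ->
  (forall v, mod_elt N x v) -> N u.
Proof.
move=> nM mx NxM; apply: (Nakayama (L := full_submod M) nM _ I) => P NP jP v _.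
have [w Nw [w' ->]] := NxM v; apply: submodD; first exact: NP.
exact/jP/I/maximal_jacobson.
Qed.

(* Every map from the copy (J + A b)/J of A/m into M extends to A/J. *)
Definition socle_liftable I M :=
  forall J (b : A) (w : M), I `<=` J -> ~ J b -> (forall a : A, m a -> a *: w = 0) ->
    exists2 z, (forall a : A, J a -> a *: z = 0) & b *: z = w.

(** Sending the class of [b] to [w] is well defined: if [c b] is in [J], then [c] is in [m], since
    [b] is not in [J]. The image of 1 under an extension to [A/J] is the required [z]. *)
Lemma rel_injective_socle_liftable I M : rel_injective I M -> socle_liftable I M.
Proof.
move=> [_ ext] J b w IJ Jb mw.
have IQ : kills I (quot_module J).
  move=> a q Ia; have [c ->] := quot_pi_surj q; rewrite -linZ; apply/quot_pi_eq0.
  by apply: (idealMr (I := J)); apply: IJ.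
pose B := cyclic_submod (quot_pi J b).
have colonP (c : A) : J (c * b) -> m c.
  apply: (@proper_sub_maximal (@residual A A^o J b)) => /=.
  by rewrite scale1r.
have [|u v v' [c uc ->] [c' uc' ->]|a u u' v v' [c uc ->] [c' uc' ->]|h hP] :=
  @linear_of_rel _ (submod_type B) M
    (fun u v => exists2 c : A, sub_val B u = c *: quot_pi J b & v = c *: w).
- by move=> u; have [c uc] := sub_valP u; exists (c *: w), c.
- apply/eqP; rewrite -subr_eq0 -scalerBl; apply/eqP/mw/colonP.
  apply/quot_pi_eq0; rewrite -[_ * b]/((c - c') *: (b : A^o)) linZ scalerBl -uc -uc'.
  by rewrite subrr.
- by exists (a * c + c'); rewrite ?linearP ?uc ?uc' scalerDl scalerA.
have [g gP] := ext _ _ (sub_val B) h IQ (@sub_val_inj _ _ _).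
have bE : g (quot_pi J b) = w.
  have [|u uE] := @sub_val_ex _ _ B (quot_pi J b); first exact: cyclic_submod_id.
  rewrite -uE gP; have [c ucb ->] := hP u.
  have : m (c - 1).
    apply/colonP/quot_pi_eq0; rewrite -[_ * b]/((c - 1) *: (b : A^o)) linZ scalerBl.
    by rewrite -ucb uE scale1r subrr.
  by move=> /mw; rewrite scalerBl scale1r => /subr0_eq.
have piE (a : A) : a *: g (quot_pi J 1) = g (quot_pi J a).
  by rewrite -!linZ; congr (g (quot_pi J _)); apply: mulr1.
exists (g (quot_pi J 1)) => [a Ja|]; last by rewrite piE.
by rewrite piE (_ : quot_pi J a = 0) ?linear0 //; apply/quot_pi_eq0.
Qed.

(** A maximal residual is a prime over [I], so in dimension zero it contains [m]. *)
Lemma socle_elt I M (N : submodule M) u :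
  (forall p, prime_ideal p -> I `<=` p -> m `<=` p) ->
  (forall (a : A) v, I a -> N (a *: v)) -> ~ N u ->
  exists2 v, ~ N v & forall a : A, m a -> N (a *: v).
Proof.
move=> dim0 IN /(maximal_residual_ex nA)[v [vmax _]].
exists v; first exact: (proj1 vmax).
move=> a ma; apply: (dim0 (residual N v) _ _ a ma); first exact: maximal_residual_prime.
by move=> b Ib; apply: IN.
Qed.

(** Induction along [0 -> M -> E -> M' -> 0]; the main point is that elements of [M'] killed by [J]
    lift to elements of [E] killed by [J]. *)
Lemma rel_injdim_socle_liftable I n M :
  (forall p, prime_ideal p -> I `<=` p -> m `<=` p) ->
  rel_injdim_le I n M -> socle_liftable I M.
Proof.
move=> dim0; elim: n M => [|n IHn] M /=; first exact: rel_injective_socle_liftable.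
move=> [E [M' [f [g [injE f_inj ex g_surj /IHn liftM']]]]].
have liftE := rel_injective_socle_liftable injE.
(* Noetherian induction on [J]: with [b] a socle element modulo [J] and [s] one modulo [I], the
   claim for [J + (b)] gives the claim for [J]. *)
have lift J : I `<=` J -> forall w, (forall a : A, J a -> a *: w = 0) ->
    exists2 e, w = g e & forall a : A, J a -> a *: e = 0.
  move: J; apply: (noetherian_ind (noetherian_regular nA)) => J IHJ IJ w Jw.
  have [J1|J1] := pselect (J 1).
    by exists 0 => [|a _]; rewrite ?linear0 ?scaler0 // -[w]scale1r Jw.
  have [a v /IJ Ja|b Jb mb] := @socle_elt I A^o J 1 dim0 _ J1.
    exact: (idealMr (I := J)).
  have I1 : ~ I 1 by move/IJ.
  have [a v Ia|s Is ms] := @socle_elt I A^o I 1 dim0 _ I1.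
    exact: (idealMr (I := I)).
  (* the socle element b w of M' lifts to the socle element s e of E *)
  have [a /mb Jab|z _ sz] := liftM' I s (b *: w) (fun _ => id) Is.
    by rewrite scalerA Jw.
  have [e ze] := g_surj z.
  have [a /ms Ias|e1 Je1 be1] := liftE J b (s *: e) IJ Jb.
    by rewrite scalerA (proj1 injE).
  (* Since [b w = s z = g (s e) = b g(e1)], the difference [w - g e1] is killed by [b] as well as by
     [J]. *)
  have [||a [c Jc [d ->]]|e2 we2 Je2] := IHJ (mod_elt J b) _ _ (w - g e1).
  - split=> [a Ja|JbJ]; first exact: mod_elt_sub.
    by apply/Jb/JbJ; have := mod_elt_scale J b (1 : A); rewrite /GRing.scale /= mulr1.
  - by move=> a /IJ; apply: mod_elt_sub.
  - rewrite scalerDl scalerBr Jw // -[c *: g e1]linZ Je1 // linear0 subrr add0r.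
    rewrite -[b *: d]/(b * d) mulrC -scalerA scalerBr -sz -linZ be1 linZ ze.
    by rewrite subrr scaler0.
  exists (e1 + e2) => [|a Ja]; first by rewrite linearD -we2 addrC subrK.
  by rewrite scalerDr Je1 // add0r Je2 //; apply: mod_elt_sub.
move=> J b w IJ Jb mw.
(* First solve in [E]. The image [g e] is killed by [J + (b)]; subtracting a lift [e'] killed by the
   same ideal brings [e] into [M] without changing [b e]. *)
have [a /mw aw|e Je be] := liftE J b (f w) IJ Jb; first by rewrite -linZ aw linear0.
have Jge (a : A) : mod_elt J b a -> a *: g e = 0.
  move=> [c Jc [d ->]]; rewrite -linZ scalerDl Je // add0r.
  rewrite -[b *: d]/(b * d) mulrC -scalerA be linZ.
  by have -> : g (f w) = 0; [apply/ex; exists w | rewrite scaler0].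
have [a /IJ|e' ge Je'] := lift (mod_elt J b) _ (g e) Jge; first exact: mod_elt_sub.
have [z ez] : exists z, e - e' = f z by apply/ex; rewrite linearB ge subrr.
exists z => [a Ja|]; apply: f_inj; rewrite linZ -ez scalerBr.
  by rewrite Je // Je' ?subrr ?linear0 //; apply: mod_elt_sub.
rewrite be Je' ?subr0 //.
by have := mod_elt_scale J b (1 : A); rewrite /GRing.scale /= mulr1.
Qed.

Lemma rel_injdim_kills I n M : rel_injdim_le I n M -> kills I M.
Proof.
case: n => [[]//|n [E [M' [f [g [[IE _] f_inj _ _ _]]]]]]; exact: kills_inj f_inj IE.
Qed.

(* Modulo a maximal regular sequence the ring is Artinian, and a nonzero module
   Q of finite injective dimension is faithful because a socle element of Q is a
   multiple of every b notin I. Nakayama's lemma lifts faithfulness back. *)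
Lemma rel_injdim_faithful d I C (N : submodule C) Q (p : {linear C -> Q}) n :
  noetherian_module C ->
  (forall q, exists u, q = p u) -> (forall u, p u = 0 <-> N u) ->
  (exists u, ~ N u) -> rel_injdim_le I n Q ->
  depth_ge m d I -> depth_ge m d N -> ~ @prime_chain A I d.+1 ->
  forall a : A, (forall u, N (a *: u)) -> I a.
Proof.
move=> nC; elim: d I N Q p n => [|d IHd] I N Q p n p_surj kerp [u0 Nu0] dimQ dI dN chI a aN.
  (* Otherwise [q] and [m] form a chain of length 1. *)
  have dim0 q : prime_ideal q -> I `<=` q -> m `<=` q.
    move=> qP Iq; apply: contrapT => mq; apply: chI.
    have qm := proper_sub_maximal (proj1 qP).
    exists (fun i => if i is 0%N then q else m); split=> -[|i] //= _.
    split; last by move=> b /Iq/qm.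
    exact: maximal_ideal_prime (proj1 locA).
  have [b v Ib|v Nv mv] := socle_elt dim0 _ Nu0.
    by apply/kerp; rewrite linZ (rel_injdim_kills dimQ).
  (* If [a] is not in [I], the socle class [p v] is a multiple of [a] in [Q], hence zero, although
     [v] is not in [N]. *)
  apply: contrapT => Ia.
  have [b /mv/kerp|z _ az] :=
    rel_injdim_socle_liftable dim0 dimQ (fun _ => id) Ia (w := p v).
    by rewrite linZ.
  by have [u zu] := p_surj z; apply/Nv/kerp; rewrite -az zu -linZ; apply/kerp.
have [x [mx [xI xN] dIx dNx]] := depth_ge_regular nA (noetherian_regular nA) nC dI dN.
have NxC : exists u, ~ mod_elt N x u.
  by apply/existsNP => NxC; apply/Nu0/(Nakayama_elt _ nC mx NxC).
(* Dimension bound 0 is impossible here: [Q] would be divisible by [x], against Nakayama. *)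
case: n dimQ => [|n] dimQ.
  have [u []] := NxC.
  have [q pq] := @rel_injective_divisible A I x Q xI dimQ (p u).
  have [v qv] := p_surj q; exists (u - x *: v); last by exists v; rewrite subrK.
  by apply/kerp; rewrite linearB linZ pq qv subrr.
have [|p' p'P] := @factor_surj _ _ _ _ p (quot_pi (mod_elt N x)) p_surj.
  by move=> u /kerp Nu; apply/quot_pi_eq0/mod_elt_sub.
have dimQ' : rel_injdim_le (mod_elt I x) n (quot_module (mod_elt N x)).
  apply: (rel_injdim_mod_elt (p := p')) dimQ => //.
  - by move=> q; have [u ->] := p_surj q; rewrite -linZ => /kerp/xN/kerp.
  - by move=> q; have [u ->] := quot_pi_surj q; exists (p u); rewrite p'P.
  - move=> q; have [u ->] := p_surj q; rewrite p'P quot_pi_eq0; split.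
      move=> [v Nv [w ->]]; exists (p w); rewrite linearD linZ.
      by rewrite (proj2 (kerp v) Nv) add0r.
    move=> [q' ]; have [w ->] := p_surj q'; rewrite -linZ => E.
    exists (u - x *: w); last by exists w; rewrite subrK.
    by apply/kerp; rewrite linearB E subrr.
have faithQ' (b : A) : (forall u, N (b *: u)) -> mod_elt I x b.
  move=> bN; apply: (IHd _ _ _ _ n (@quot_pi_surj _ _ _) _ NxC dimQ' dIx dNx).
  - by move=> u; rewrite quot_pi_eq0.
  - by move/(prime_chain_mod_elt nA xI).
  - by move=> u; apply: mod_elt_sub.
(* Let [K] be the annihilator of [C/N]. An element of [K] is [i + x c] with [i] in [I]; then [x c]
   is in [K], and so is [c] because [x] is regular on [C/N]. Thus [K] lies in [I + m K], and
   Nakayama applies. *)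
have K0 : forall u, N ((0 : A) *: u) by move=> u; rewrite scale0r; apply: submod0.
have KP (c : A) (b b' : A^o) : (forall u, N ((b : A) *: u)) ->
    (forall u, N ((b' : A) *: u)) ->
    forall u, N ((c *: b + b' : A) *: u).
  move=> bN b'N u; rewrite scalerDl; apply: submodD; last exact: b'N.
  by rewrite -[c *: b]/(c * b) -scalerA; apply/submodZ/bN.
apply: (@Nakayama _ A^o I (@Submodule _ A^o _ K0 KP) (noetherian_regular nA) _ a aN).
move=> P IP jP b bN; have [i Ii [c bE]] := faithQ' b bN; rewrite bE.
apply: submodD; first exact: IP.
apply: jP; first exact: maximal_jacobson.
move=> u /=; apply: xN; rewrite scalerA.
have -> : x * c = b - i by rewrite bE [i + _]addrC addrK.
rewrite scalerBl; apply: submodB; first exact: bN.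
by apply/kerp; rewrite linZ (rel_injdim_kills dimQ).
Qed.

End LocalRing.

(** * Canonical modules over a local ring are faithful *)

Section CanonicalModules.
Context {A : comPzRingType}.
Implicit Types (M E : lmodType A).

Let zero_ideal : ideal A := zero_submod A^o.

Lemma injective_rel_injective E : injective_module E -> rel_injective zero_ideal E.
Proof.
move=> injE; split=> [a u ->|U V i f _]; first by rewrite scale0r.
exact: injE.
Qed.

(** [M] is the cosyzygy in degree [i] and [k] counts the degrees left. For [k = 0] the next term of
    the resolution vanishes, so [M] is isomorphic to [E n]. *)
Lemma resolution_rel_injdim n (E : nat -> lmodType A)
    (d : forall i, {linear E i -> E i.+1}) :
  (forall i, injective_module (E i)) ->
  (forall i, exact_at (d i) (d i.+1)) ->
  (forall i, (n < i)%N -> forall x : E i, x = 0) ->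
  forall k i M (e : {linear M -> E i}), (i + k)%N = n ->
    injective e -> exact_at e (d i) -> rel_injdim_le zero_ideal k M.
Proof.
move=> injE exE En0; elim=> [|k IHk] i M e ikn e_inj ex /=.
  apply: rel_injective_iso e_inj _ (injective_rel_injective (injE i)) => u.
  by apply/ex/En0; rewrite -ikn addn0.
pose K := preim_submod (d i.+1) (zero_submod _).
have [|g gP] := @corestrict _ _ _ K (d i).
  by move=> u; apply/exE; exists u.
exists (E i), (submod_type K), e, g; split=> //.
- exact: injective_rel_injective.
- move=> u; rewrite -ex -gP; split=> [->|/ker_inj]; first by rewrite linear0.
  by apply; exact: sub_val_inj.
- move=> w; have /exE[u wu] := sub_valP w.
  by exists u; apply: (@sub_val_inj _ _ K); rewrite gP.
apply: (IHk i.+1 _ (sub_val K)); first by rewrite addSnnS.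
  exact: sub_val_inj.
move=> u; split=> [du|[v ->]]; last exact: (sub_valP v).
by have [v vu] := @sub_val_ex _ _ K u du; exists v.
Qed.

Lemma finite_injective_rel_injdim M : finite_injective_dim M ->
  exists n, rel_injdim_le zero_ideal n M.
Proof.
move=> [n [E [e [d [injE [e_inj ex] exE En0]]]]]; exists n.
exact: (resolution_rel_injdim injE exE En0 (add0n n) e_inj ex).
Qed.

Lemma quotient_dim_le (I : set A) d e : quotient_dim I d -> quotient_dim I e -> (d <= e)%N.
Proof.
move=> [[p [pP plt]] _] [_ che]; rewrite leqNgt; apply/negP => lt_ed; apply: che.
exists p; split=> i ie; first exact/pP/(leq_trans ie).
exact/plt/(leq_trans ie).
Qed.

Lemma annihilator_regular : annihilator (A^o : lmodType A) = [set 0].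
Proof.
apply/seteqP; split=> [a /(_ 1) a1|_ -> u]; last by rewrite scale0r.
by rewrite /= -[a]mulr1; apply: a1.
Qed.

Lemma canonical_faithful M : noetherian_ring A -> cm_local_ring A ->
  local_canonical_module M -> forall a : A, (forall u : M, a *: u = 0) -> a = 0.
Proof.
move=> nA [m1 [loc1 [d1 [[dA _] dimA]]]].
move=> [m [locA Mfg [d [[dM _] _ dimA']] _ /finite_injective_rel_injdim[n dimM]]] a aM.
(* [d1] is the depth of the ring, which the Cohen-Macaulay property equates with its dimension; [d]
   is both that dimension and the depth of [M]. *)
have dE : d1 = d.
  move: dimA; rewrite /module_dim annihilator_regular => dimA.
  by apply/eqP; rewrite eqn_leq (quotient_dim_le dimA dimA') (quotient_dim_le dimA' dimA).
subst d1.
have {}dA : regular_seq_in m A^o d.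
  have [s [sd sm sreg]] := dA; exists s; split=> // b /sm.
  by rewrite (proj2 locA m1 (proj1 loc1)).
apply: (rel_injdim_faithful nA locA (I := zero_ideal) (N := zero_submod M)
  (p := idfun) (n := n) (d := d)).
- exact: noetherian_fg.
- by move=> q; exists q.
- by [].
- exact: regular_seq_in_nonzero dM.
- exact: dimM.
- exact: regular_seq_in_depth_ge.
- exact: regular_seq_in_depth_ge.
- exact: (proj2 dimA').
- exact: aM.
Qed.

End CanonicalModules.

(** * Noetherian localizations and localized annihilators *)

Section Localization.
Context {A : comPzRingType} (S : mulset A).

Lemma rfrac0 s : rfrac 0 s = 0 :> loc_ring S.
Proof. by apply: rfrac_eq; rewrite !mulr0. Qed.

Lemma rfracDl a b s : rfrac (a + b) s = rfrac a s + rfrac b s :> loc_ring S.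
Proof. by rewrite rfracD; apply: rfrac_eq; rewrite ?denE; ring. Qed.

Lemma rfracM a b s t : rfrac a s * rfrac b t = rfrac (a * b) (denomM s t) :> loc_ring S.
Proof. exact: loc_mulE. Qed.

(** Generators of the ideal of those [a] with [a/1] in [K] also generate [K]. *)
Lemma loc_noetherian : noetherian_ring A -> noetherian_ring (loc_ring S).
Proof.
move=> nA K; pose num a := rfrac a (denom1 S).
have K0 : K (num 0) by rewrite /num rfrac0; apply: submod0.
have KP (c : A) (a b : A^o) : K (num a) -> K (num b) -> K (num (c *: a + b)).
  move=> Ka Kb; have -> : num (c *: a + b) = num c * num a + num b.
    by rewrite /num rfracM rfracD; apply: rfrac_eq; rewrite ?denE /GRing.scale /=; ring.
  exact: submodZD.
have [n [x [Kx xK]]] := nA (@Submodule A A^o _ K0 KP).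
exists n, (fun i => num (x i)); split=> // u; have [a [s ->]] := rfrac_surj u => Kas.
have [|c aE] := xK a.
  rewrite /= (_ : num a = rfrac (den s) (denom1 S) * rfrac a s).
    exact: submodZ.
  by rewrite rfracM; apply: rfrac_eq; rewrite ?denE; ring.
exists (fun i => rfrac (c i) s); rewrite aE.
rewrite (big_morph (fun a => rfrac a s) (fun a b => rfracDl a b s) (rfrac0 s)).
apply: eq_bigr => i _; rewrite -[RHS]/(rfrac (c i) s * num (x i)) rfracM.
by apply: rfrac_eq; rewrite ?denE /GRing.scale /=; ring.
Qed.

Lemma loc_annihilator (M : lmodType A) (a : A) :
  (forall u : M, a *: u = 0) -> forall y : loc_module S M, rfrac a (denom1 S) *: y = 0.
Proof.
move=> aM y; have [u [s ->]] := frac_surj y.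
rewrite [_ *: _]loc_scaleE aM; apply: frac_eq; by rewrite !scaler0.
Qed.

End Localization.

(** * Descent from the localizations and the equivalence *)

(** If [a] is nonzero, its annihilator lies in a maximal ideal [m]; but [a/1] vanishes in the
    localization at [m], so some [w] outside [m] kills [a]. *)
Lemma canonical_module_faithful (A : comPzRingType) (omega : lmodType A) (a : A) :
  noetherian_ring A -> cohen_macaulay_ring A -> canonical_module omega ->
  (forall u : omega, a *: u = 0) -> a = 0.
Proof.
move=> nA cmA [_ can] aomega; pose I := @residual A A^o (zero_submod A^o) a.
suff : I 1 by rewrite /= scale1r.
apply: contrapT => /(maximal_above nA)[m mM Im].
have := canonical_faithful (loc_noetherian nA) (cmA m mM) (can m mM)
  (loc_annihilator aomega).
rewrite -[0]/(rfrac 0 (denom1 _)) => /rfracP[w mw].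
rewrite mulr0 mulr0 mul1r => wa.
by apply/mw/Im.
Qed.

(* If 1 lies in J^(k+1) M : J^k M, then J^k M = J (J^k M) = 0. *)
Lemma stable_colon_annihilator (A : comPzRingType) (M : lmodType A) :
  noetherian_ring A -> fg_module M -> stable_colon (jacobson A) 1 M 1 ->
  exists k, ideal_exp (jacobson A) k `<=` annihilator M.
Proof.
move=> nA Mfg [k _ JkM]; exists k => a Jka u.
(* [span G] plays the role of [J^k M]. *)
pose G := [set w | exists2 b : A, ideal_exp (jacobson A) k b & exists v : M, w = b *: v].
apply: (Nakayama (N := zero_submod M) (L := span G) (noetherian_fg nA Mfg)); last first.
  by apply: sub_span; exists a => //; exists u.
move=> P _ JP; apply: span_min => _ [b Jkb [v ->]].
(* Membership of 1 in the colon puts [b v] in [J^(1+k) M], whose coefficients split as sums of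
   products from [J] and [J^k]. *)
have [|n [c [x [Jc _]]]] := JkM (b *: v).
  by exists 1%N, (fun=> b), (fun=> v); split=> //; rewrite big_ord1.
rewrite scale1r => ->; apply: submod_sum => i.
have [n' [j [y [Jj Jky ->]]]] := Jc i.
rewrite scaler_suml; apply: submod_sum => i'; rewrite -scalerA.
by apply: JP => //; apply: sub_span; exists (y i'); [exact: Jky | exists (x i)].
Qed.

(** Once [J^k = 0], the colon of index [k] is taken over [J^k M = 0]. *)
Lemma hilbert_stable_colon (A : comPzRingType) (M : lmodType A) n :
  hilbert_ring A -> stable_colon (jacobson A) n M = [set: A].
Proof.
move=> [k Jk0]; apply/seteqP; split=> // a _; exists k => // u [r [c [x [Jc _ ->]]]].
rewrite big1 => [|i _]; last by rewrite (Jk0 _ (Jc i)) scale0r.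
rewrite scaler0; exists 0%N, (fun=> 0), (fun=> 0); split=> [[]|[]|] //.
by rewrite big_ord0.
Qed.

Theorem theorem1p1 (A : comPzRingType) (omega : lmodType A)
    (Anoeth : noetherian_ring A)
    (Acm : cohen_macaulay_ring A)
    (omega_can : canonical_module omega) :
  [<-> hilbert_ring A;
       stable_colon (jacobson A) 1 omega = [set: A];
       forall n : nat, (1 <= n)%N ->
         stable_colon (jacobson A) n omega = [set: A]].
Proof.
(* Some power of [J] kills [omega], hence is zero by faithfulness. *)
have imp21 : stable_colon (jacobson A) 1 omega = [set: A] -> hilbert_ring A.
  move=> E; have [|k Jk] := stable_colon_annihilator Anoeth (proj1 omega_can).
    by rewrite E.
  exists k => a /Jk; exact: (canonical_module_faithful Anoeth Acm omega_can).
tfae; first exact: hilbert_stable_colon.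
- by move=> /imp21 hA n _; apply: hilbert_stable_colon.
- by move=> /(_ 1%N isT)/imp21.
Qed.
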